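(* Let $X$ be a separable real Banach space containing (an isomorphic copy of) $c_0$. Then, for every $0<\varepsilon<2$, there is an equivalent Read norm $q_\varepsilon$ on $X$ such that: (a) $(X,q_\varepsilon)$ is strictly convex; (b) $(X,q_\varepsilon)^*$ is strictly convex, so $(X,q_\varepsilon)$ is smooth; (c) $(X,q_\varepsilon)^*$ is $(2-\varepsilon)$-rough, equivalently, every slice of the unit ball of $(X,q_\varepsilon)$ has diameter $\ge 2-\varepsilon$; and moreover, if $X^*$ is separable, also: (d) $(X,q_\varepsilon)^{**}$ is strictly convex, so $(X,q_\varepsilon)^*$ is smooth.
   Context: All Banach spaces are real. $\mathrm{NA}(X,p)$ is the set of functionals $f\in X^*$ attaining their norm on the unit sphere of $(X,p)$. An equivalent norm $p$ on $X$ is a Read norm if $\mathrm{NA}(X,p)$ does not contain any two-dimensional linear subspace. A Banach space is strictly convex if its unit sphere contains no non-trivial segment; it is smooth if its norm is Gâteaux differentiable at every non-zero element. A norm $\|\cdot\|$ on $X$ is $\rho$-rough ($0<\rho\le 2$) if $\limsup_{\|h\|\to0}\frac{\|x+h\|+\|x-h\|-2\|x\|}{\|h\|}\ge\rho$ for every $x\in X$; a space is called $\rho$-rough if its norm is. A slice of the unit ball $B$ is a set $\{x\in B: f(x)>\sup_B f-\alpha\}$ with $f$ a non-zero bounded linear functional and $\alpha>0$. Diameters are measured in the norm $q_\varepsilon$. *)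

(* Defs.v *)
From HB Require Import structures.
From mathcomp Require Import all_boot all_order all_algebra.
From mathcomp Require Import all_classical all_reals all_analysis.
Set Implicit Arguments.
Unset Strict Implicit.
Unset Printing Implicit Defensive.
Import Order.TTheory GRing.Theory Num.Theory.
Import numFieldNormedType.Exports.
Local Open Scope classical_set_scope.
Local Open Scope ring_scope.

Section Dual.
Context {R : realType} (X : normedModType R).
Implicit Types f g : X -> R^o.

Definition cont_linear : {pred X -> R^o} :=
  mem [set f | linear f /\ continuous f].

Lemma cont_linear_submod_closed : submod_closed cont_linear.
Proof.
split=> [|a f g]; rewrite !inE /=.
  split; last by move=> x; exact: cvg_cst.
  by move=> a x y; rewrite /= scaler0 addr0.
move=> [fl fc] [gl gc]; split.
  move=> b x y; rewrite !fctE fl gl !scalerDr !scalerA (mulrC a b).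
  by rewrite addrACA.
move=> x; apply: (@continuousD _ _ _ (a *: f) g x _ (gc x)).
by apply: cvgZl_tmp; exact: fc.
Qed.

HB.instance Definition _ := GRing.isSubmodClosed.Build _ _ cont_linear
  cont_linear_submod_closed.

Record dual := Dual { dual_fun :> X -> R^o ; _ : dual_fun \in cont_linear }.

HB.instance Definition _ := [isSub for dual_fun].
HB.instance Definition _ := [Choice of dual by <:].
HB.instance Definition _ := [SubChoice_isSubLmodule of dual by <:].

Lemma dual_linear (f : dual) : linear f.
Proof. by case: f => f /= /set_mem[]. Qed.

Lemma dual_continuous (f : dual) : continuous f.
Proof. by case: f => f /= /set_mem[]. Qed.

HB.instance Definition _ (f : dual) :=
  GRing.isLinear.Build R X R^o *:%R f (dual_linear f).

Definition dual_norm (f : dual) : R :=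
  sup [set `|f x| | x in [set x | `|x| <= 1]].

Lemma dual_bounded (f : dual) :
  has_sup [set `|f x| | x in [set x | `|x| <= 1]].
Proof.
split; first by exists `|f 0|, 0 => //=; rewrite normr0.
have /linear_bounded_continuous/linear_boundedP := @dual_continuous f.
move=> /pinfty_ex_gt0[r r0 fr].
exists r => _ [x /= x1 <-]; apply: (le_trans (fr x)).
by rewrite ler_piMr// ltW.
Qed.

Lemma dual_norm_ub (f : dual) (x : X) : `|x| <= 1 -> `|f x| <= dual_norm f.
Proof.
by move=> x1; apply: ub_le_sup; [exact: (dual_bounded f).2|exists x].
Qed.

Lemma dual_norm_le (f : dual) (M : R) :
  (forall x, `|x| <= 1 -> `|f x| <= M) -> dual_norm f <= M.
Proof.
move=> fM; apply: ge_sup; first exact: (dual_bounded f).1.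
by move=> _ [x x1 <-]; exact: fM.
Qed.

Lemma dual_normD (f g : dual) : dual_norm (f + g) <= dual_norm f + dual_norm g.
Proof.
apply: dual_norm_le => x x1; apply: (le_trans (ler_normD _ _)).
by apply: lerD; exact: dual_norm_ub.
Qed.

Lemma dual_normZ (a : R) (f : dual) : dual_norm (a *: f) = `|a| * dual_norm f.
Proof.
have le b (g : dual) : dual_norm (b *: g) <= `|b| * dual_norm g.
  apply: dual_norm_le => x x1; rewrite -[leLHS]/(`|b * g x|) normrM.
  by apply: ler_wpM2l => //; exact: dual_norm_ub.
apply/eqP; rewrite eq_le le/=; have [->|a0] := eqVneq a 0.
  rewrite normr0 mul0r; apply: le_trans (dual_norm_ub _ (x := 0) _) => //.
  by rewrite normr0.
rewrite -ler_pdivlMl ?normr_gt0// -normfV.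
by apply: le_trans (le _ _); rewrite scalerA mulVf// scale1r.
Qed.

Lemma dual_norm0_eq0 (f : dual) : dual_norm f = 0 -> f = 0.
Proof.
move=> f0; apply/val_inj/funext => x /=.
have [->|x0] := eqVneq x 0; first by rewrite [LHS]linear0.
have : `|f (`|x|^-1 *: x)| <= 0.
  rewrite -f0; apply: dual_norm_ub.
  by rewrite normrZ normfV normr_id mulVf// normr_eq0.
rewrite normr_le0 linearZ/= mulf_eq0 invr_eq0 normr_eq0 (negbTE x0)/=.
by move=> /eqP.
Qed.

HB.instance Definition _ :=
  Lmodule_isNormed.Build R dual dual_normD dual_normZ dual_norm0_eq0.

End Dual.

Section CZero.
Context (R : realType).

Definition vanishing : {pred nat -> R^o} :=
  mem [set u | u n @[n --> \oo] --> (0 : R^o)].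

Lemma vanishing_submod_closed : submod_closed vanishing.
Proof.
split=> [|a u v]; rewrite !inE /=; first exact: cvg_cst.
move=> u0 v0.
have : (a \*: u \+ v) n @[n --> \oo] --> a *: (0 : R^o) + 0.
  by apply: cvgD => //; exact: cvgZl_tmp.
by rewrite scaler0 addr0.
Qed.

HB.instance Definition _ := GRing.isSubmodClosed.Build _ _ vanishing
  vanishing_submod_closed.

Record c0 := CZero { c0_seq :> nat -> R^o ; _ : c0_seq \in vanishing }.

HB.instance Definition _ := [isSub for c0_seq].
HB.instance Definition _ := [Choice of c0 by <:].
HB.instance Definition _ := [SubChoice_isSubLmodule of c0 by <:].

Definition c0_norm (u : c0) : R := sup [set `|u n| | n in [set: nat]].

Lemma c0_bounded (u : c0) : has_sup [set `|u n| | n in [set: nat]].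
Proof.
split; first by exists `|u 0%N|, 0%N.
have /set_mem/= u0 : c0_seq u \in vanishing by case: u.
have /cvg_seq_bounded[M [_ uM]] : cvgn (c0_seq u).
  by apply/cvg_ex; exists 0.
by exists (M + 1) => _ [n _ <-]; apply: uM => //; rewrite ltrDl.
Qed.

Lemma c0_norm_ub (u : c0) n : `|u n| <= c0_norm u.
Proof. by apply: ub_le_sup; [exact: (c0_bounded u).2|exists n]. Qed.

Lemma c0_norm_le (u : c0) (M : R) : (forall n, `|u n| <= M) -> c0_norm u <= M.
Proof.
move=> uM; apply: ge_sup; first exact: (c0_bounded u).1.
by move=> _ [n _ <-]; exact: uM.
Qed.

Lemma c0_normD (u v : c0) : c0_norm (u + v) <= c0_norm u + c0_norm v.
Proof.
apply: c0_norm_le => n; apply: (le_trans (ler_normD _ _)).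
by apply: lerD; exact: c0_norm_ub.
Qed.

Lemma c0_normZ (a : R) (u : c0) : c0_norm (a *: u) = `|a| * c0_norm u.
Proof.
have le b (v : c0) : c0_norm (b *: v) <= `|b| * c0_norm v.
  apply: c0_norm_le => n; rewrite -[leLHS]/(`|b * v n|) normrM.
  by apply: ler_wpM2l => //; exact: c0_norm_ub.
apply/eqP; rewrite eq_le le/=; have [->|a0] := eqVneq a 0.
  by rewrite normr0 mul0r; apply: le_trans (c0_norm_ub _ 0%N).
rewrite -ler_pdivlMl ?normr_gt0// -normfV.
by apply: le_trans (le _ _); rewrite scalerA mulVf// scale1r.
Qed.

Lemma c0_norm0_eq0 (u : c0) : c0_norm u = 0 -> u = 0.
Proof.
move=> u0; apply/val_inj/funext => n /=; apply/eqP.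
by rewrite -normr_le0 -u0; exact: c0_norm_ub.
Qed.

HB.instance Definition _ :=
  Lmodule_isNormed.Build R c0 c0_normD c0_normZ c0_norm0_eq0.

End CZero.

(* The two-sided estimate says that T is an isomorphism of Y onto its range. *)
Definition contains_iso_copy {R : realType} (Y X : normedModType R) : Prop :=
  exists T : {linear Y -> X}, exists m M : R,
    0 < m /\ forall y : Y, m * `|y| <= `|T y| <= M * `|y|.

Definition separable (T : topologicalType) : Prop :=
  exists2 S : set T, countable S & dense S.

Section Renorming.
Context {R : realType} (X : normedModType R).

Record equiv_norm := EquivNorm {
  eqnorm :> X -> R ;
  eqnormD : forall x y, eqnorm (x + y) <= eqnorm x + eqnorm y ;
  eqnormZ : forall (a : R) x, eqnorm (a *: x) = `|a| * eqnorm x ;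
  eqnorm0_eq0 : forall x, eqnorm x = 0 -> x = 0 ;
  eqnorm_equiv : exists m M : R,
    0 < m /\ forall x, m * `|x| <= eqnorm x <= M * `|x|
}.

(* The space (X, q): the vector space X, whose norm and topology are those
   defined by q. *)
Definition renormed (q : equiv_norm) : Type := X.

HB.instance Definition _ (q : equiv_norm) := GRing.Lmodule.on (renormed q).
HB.instance Definition _ (q : equiv_norm) :=
  @Lmodule_isNormed.Build R (renormed q) q
    (@eqnormD q) (@eqnormZ q) (@eqnorm0_eq0 q).

End Renorming.

Section Geometry.
Context {R : realType} (V : normedModType R).

Definition strictly_convex : Prop := forall x y : V,
  `|x| = 1 -> `|y| = 1 ->
  (forall t : R, 0 <= t <= 1 -> `|(1 - t) *: x + t *: y| = 1) -> x = y.

(* All two-sided directional derivatives exist and together form a bounded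
   linear functional of the direction h. *)
Definition gateaux_differentiable (f : V -> R^o) (x : V) : Prop :=
  exists d : dual V, forall h : V, is_derive x h f (d h).

Definition smooth : Prop := forall x : V, x != 0 ->
  gateaux_differentiable (fun z : V => `|z| : R^o) x.

(* The limsup is over h -> 0 with h <> 0, in extended reals. *)
Definition rough (rho : R) : Prop := forall x : V,
  (rho%:E <= limf_esup
     (fun h : V => ((`|x + h| + `|x - h| - 2 * `|x|) / `|h|)%:E) (0%R : V)^')%E.

Definition unit_ball : set V := [set x | `|x| <= 1].

Definition slice (f : dual V) (alpha : R) : set V :=
  [set x | unit_ball x /\ f x > sup (f @` unit_ball) - alpha].

Definition diameter (A : set V) : \bar R :=
  ereal_sup [set `|xy.1 - xy.2|%:E | xy in A `*` A].

(* Since the sphere is symmetric, `|f x| = `|f| for some x of the sphere iff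
   f x = `|f| for some such x. *)
Definition norm_attaining : set (dual V) :=
  [set f : dual V | exists x : V, `|x| = 1 /\ `|f x| = `|f|].

Definition two_dim_subspace (E : set V) : Prop := exists u v : V,
  (forall a b : R, a *: u + b *: v = 0 -> a = 0 /\ b = 0) /\
  E = [set a *: u + b *: v | a in [set: R] & b in [set: R]].

End Geometry.

Definition read_norm {R : realType} (V : normedModType R) : Prop :=
  ~ exists E : set (dual V),
      two_dim_subspace E /\ E `<=` @norm_attaining R V.

(* Main.v *)
(* The norm is the fourth root of
     [Psi x = inf_w (b (x - D w) ^ 4 + |w|_4 ^ 4) + sum_k (a_k x) ^ 4].
   Here [b] is an equivalent norm equal to [max (|T x|, |x - P x|)], where [T]
   is a bounded map onto [c0] that sends vectors [e_i] of the given copy of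
   [c0] to the unit vectors and [P] is the corresponding projection (as in
   Sobczyk's theorem, after passing to a subsequence); [D] is a compact map
   with dense range; and the functionals [a_k] approximate, each infinitely
   often and up to scaling, all elements of a countable group [G] of
   functionals separating points.

   The fourth powers of the [a_k] make the norm strictly convex, uniformly so
   in each direction [a_k], and this passes to the bidual if [G] is dense in the
   dual. The infimal convolution with [D] makes the norm uniformly smooth in
   a dense set of directions, hence the dual norm strictly convex. Neither of
   them destroys the property of [c0] that adding [t e_i], with [|t|] almost
   [b x] and [i] large, does not increase the norm by much: so slices are large.

   For small [t] adding [t e_i] does not increase the infimal convolution at
   all, so a functional attaining its norm at [x] satisfies
   [f (e_i) = l * sum_k (a_k x) ^ 3 * a_k (e_i)] for large [i]. The [a_k] are
   perturbed so that these values determine the coefficients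
   [l * (a_k x) ^ 3], which therefore depend linearly on [f] on a linear space
   of norm attaining functionals. By approximation
   [c * (g z) ^ 3 = a * (g x) ^ 3 + b * (g y) ^ 3] for all [g] in [G], and this is
   impossible for linearly independent [x] and [y]. *)

From HB Require Import structures.
Require Import Defs.
From mathcomp Require Import all_boot all_order all_algebra.
From mathcomp Require Import all_classical all_reals all_analysis.
From mathcomp Require Import ring lra.
Set Implicit Arguments.
Unset Strict Implicit.
Unset Printing Implicit Defensive.
Import Order.TTheory GRing.Theory Num.Theory.
Import numFieldNormedType.Exports.
Local Open Scope classical_set_scope.
Local Open Scope ring_scope.

(** * The Hahn-Banach theorem *)

Section HahnBanach.
Context {R : realType} {V : lmodType R}.
Implicit Types (p : V -> R) (K : set (V * R)).

Definition sublinear p := (forall x y, p (x + y) <= p x + p y) /\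
  (forall t x, 0 <= t -> p (t *: x) <= t * p x).

Lemma sublinear0 p : sublinear p -> p 0 = 0.
Proof.
move=> [pD pZ]; apply/eqP; rewrite eq_le; apply/andP; split.
  by have := pZ 0 0 (lexx _); rewrite scale0r mul0r.
by have := pD 0 0; rewrite addr0 -subr_ge0 addrK.
Qed.

Lemma sublinear_opp p x : sublinear p -> - p (- x) <= p x.
Proof.
move=> sp; have := sp.1 x (- x); rewrite subrr sublinear0// => h.
by rewrite lerNl -subr_ge0 opprK addrC.
Qed.

(** A pair [(x, r)] of [K] stands for the constraint [r <= f x] on a linear functional [f]; such
    constraints may be added and scaled. *)
Definition cone K := [/\ K (0, 0),
  (forall a b, K a -> K b -> K (a.1 + b.1, a.2 + b.2)) &
  (forall t a, 0 <= t -> K a -> K (t *: a.1, t * a.2))].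

(** A linear [f <= p] obeying the constraints has [f x = f (x + a.1) - f a.1 <= p (x + a.1) - a.2],
    so this infimum is the bound that [p] and [K] together put on [f]. *)
Definition cone_inf p K (x : V) : R := inf [set p (x + a.1) - a.2 | a in K].

Section cone_inf.
Variables (p : V -> R) (K : set (V * R)).
Hypotheses (sp : sublinear p) (cK : cone K) (Kp : forall a, K a -> a.2 <= p a.1).

Let lb x : has_inf [set p (x + a.1) - a.2 | a in K].
Proof.
split; first by exists (p (x + 0) - 0), (0, 0) => //; case: cK.
exists (- p (- x)) => _ [a Ka <-]; have := sp.1 (x + a.1) (- x).
by rewrite addrAC subrr add0r; have := Kp Ka; lra.
Qed.

Lemma cone_inf_le x a : K a -> cone_inf p K x <= p (x + a.1) - a.2.
Proof. by move=> Ka; apply: ge_inf; [exact: (lb x).2|exists a]. Qed.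

Lemma cone_inf_ge x c :
  (forall a, K a -> c <= p (x + a.1) - a.2) -> c <= cone_inf p K x.
Proof.
move=> h; apply: lb_le_inf; first exact: (lb x).1.
by move=> _ [a Ka <-]; exact: h.
Qed.

Lemma cone_inf_id x : cone_inf p K x <= p x.
Proof.
by case: cK => K0 _ _; have := cone_inf_le x K0; rewrite /= addr0 subr0.
Qed.

(** Conversely, a linear [f] below [cone_inf p K] has [- f a.1 <= - a.2], so it obeys every
    constraint. *)
Lemma cone_inf_opp a : K a -> cone_inf p K (- a.1) <= - a.2.
Proof.
by move=> Ka; have := cone_inf_le (- a.1) Ka; rewrite addNr sublinear0// sub0r.
Qed.

Lemma cone_inf_sublinear : sublinear (cone_inf p K).
Proof.
have [K0 KD KZ] := cK; split=> [x y|t x t0].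
  rewrite -lerBlDr; apply: cone_inf_ge => a Ka.
  rewrite lerBlDr -lerBlDl; apply: cone_inf_ge => b Kb.
  rewrite lerBlDr; apply: le_trans (cone_inf_le _ (KD _ _ Ka Kb)) _ => /=.
  by rewrite addrACA; have := sp.1 (x + a.1) (y + b.1); lra.
have [->|tn0] := eqVneq t 0.
  by rewrite mul0r scale0r; apply: le_trans (cone_inf_id _) _; rewrite sublinear0.
have tp : 0 < t by rewrite lt_neqAle eq_sym tn0.
rewrite -ler_pdivrMl//; apply: cone_inf_ge => a Ka.
rewrite ler_pdivrMl//; apply: le_trans (cone_inf_le _ (KZ _ _ t0 Ka)) _ => /=.
by rewrite -scalerDr mulrBr lerB// sp.2.
Qed.

End cone_inf.

(** Zorn's lemma with pointwise infima of chains, which are finite because every member is bounded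
    below by [- p (- x)]. For subadditivity, the smaller of two members of the chain serves at both
    points. *)
Lemma minimal_sublinear p : sublinear p -> exists s, [/\ sublinear s,
  (forall x, s x <= p x) &
  forall s', sublinear s' -> (forall x, s' x <= s x) -> s' = s].
Proof.
move=> sp.
pose T := {s | sublinear s /\ forall x, s x <= p x}.
(* The order is reversed: a maximal element is a minimal functional. *)
pose le (s s' : T) := `[< forall x, sval s' x <= sval s x >].
have [|||A Ach|[m [sm mp]] mmax] := @Zorn T le.
- by move=> s; apply/asboolP.
- by move=> r s t /asboolP a /asboolP b; apply/asboolP => x; exact: le_trans (b x) (a x).
- move=> [s hs] [t ht] /asboolP/= ts /asboolP/= st.
  have e : s = t by apply/funext => x; apply/eqP; rewrite eq_le ts st.
  by subst t; rewrite (Prop_irrelevance hs ht).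
- have [[s0 As0]|A0] := pselect (exists s, A s); last first.
    by exists (exist _ p (conj sp (fun x => lexx (p x)))) => r Ar; case: A0; exists r.
  pose E x := (fun s : T => sval s x) @` A.
  have hE x : has_inf (E x).
    split; first by exists (sval s0 x), s0.
    exists (- p (- x)) => _ [[s [ss sp']] _ <-] /=.
    by apply: le_trans (sublinear_opp x ss); rewrite lerN2.
  have leE x (s : T) : A s -> inf (E x) <= sval s x.
    by move=> As; apply: ge_inf; [exact: (hE x).2|exists s].
  have geE x c : (forall s : T, A s -> c <= sval s x) -> c <= inf (E x).
    move=> h; apply: lb_le_inf; first exact: (hE x).1.
    by move=> _ [s As <-]; exact: h.
  have sE : sublinear (fun x => inf (E x)).
    split=> [x y|t x t0] /=.
      rewrite -lerBlDr; apply: (geE x) => s As; rewrite lerBlDr -lerBlDl.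
      apply: (geE y) => s' As'; rewrite lerBlDr.
      have [/asboolP h|/asboolP h] := Ach _ _ As As'.
        apply: le_trans (leE _ _ As') _; case: (svalP s') => -[sD _] _.
        by apply: le_trans (sD _ _) _; rewrite addrC lerD.
      apply: le_trans (leE _ _ As) _; case: (svalP s) => -[sD _] _.
      by apply: le_trans (sD _ _) _; rewrite addrC lerD.
    have [->|tn0] := eqVneq t 0.
      rewrite mul0r scale0r; apply: le_trans (leE _ _ As0) _.
      by rewrite sublinear0//; case: (svalP s0).
    have tp : 0 < t by rewrite lt_neqAle eq_sym tn0.
    rewrite -ler_pdivrMl//; apply: (geE x) => s As; rewrite ler_pdivrMl//.
    by apply: le_trans (leE _ _ As) _; case: (svalP s) => -[_ sZ] _; exact: sZ.
  have Ep x : inf (E x) <= p x.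
    by apply: le_trans (leE _ _ As0) _; case: (svalP s0).
  exists (exist _ (fun x => inf (E x)) (conj sE Ep)) => s As.
  by apply/asboolP => x /=; exact: leE.
exists m; split=> // s' ss' s'm.
have s'p x : s' x <= p x by exact: le_trans (s'm x) (mp x).
have := mmax (exist _ s' (conj ss' s'p)); rewrite /le => h.
by have /(congr1 sval) := h (asboolT s'm).
Qed.

(* A minimal sublinear functional [s] is linear: lowering it along the ray
   through [y] gives [s (- y) <= - s y]. *)
Lemma mazur_orlicz p K : sublinear p -> cone K ->
  (forall a, K a -> a.2 <= p a.1) ->
  exists f : {linear V -> R^o}, (forall x, f x <= p x) /\
    forall a, K a -> a.2 <= f a.1.
Proof.
move=> sp cK Kp.
have [s [ss sle smin]] := minimal_sublinear (cone_inf_sublinear sp cK Kp).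
have sN y : s (- y) = - s y.
  pose K' := [set (t *: y, t * s y) | t in [set t | 0 <= t]].
  have cK' : cone K'.
    split; first by exists 0 => //=; rewrite scale0r mul0r.
      move=> _ _ [t t0 <-] [u u0 <-]; exists (t + u); first exact: addr_ge0.
      by rewrite /= scalerDl mulrDl.
    move=> t _ t0 [u u0 <-]; exists (t * u); first exact: mulr_ge0.
    by rewrite /= scalerA mulrA.
  have K's a : K' a -> a.2 <= s a.1.
    move=> [t t0 <-] /=; have [->|tn0] := eqVneq t 0.
      by rewrite mul0r scale0r sublinear0.
    have tp : 0 < t by rewrite lt_neqAle eq_sym tn0.
    rewrite -ler_pdivlMl//.
    have := ss.2 t^-1 (t *: y); rewrite scalerA mulVf// scale1r; apply.
    by rewrite invr_ge0.
  have e := smin _ (cone_inf_sublinear ss cK' K's) (cone_inf_id ss cK' K's).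
  have K'y : K' (y, s y) by exists 1; rewrite /= ?scale1r ?mul1r ?ler01.
  have := cone_inf_opp ss cK' K's K'y; rewrite /= e => h.
  apply/eqP; rewrite eq_le h /=.
  by have := sublinear_opp y ss; rewrite lerNl.
have sD x y : s (x + y) = s x + s y.
  apply/eqP; rewrite eq_le ss.1/=.
  have := ss.1 (x + y) (- y); rewrite addrK sN; lra.
have sZ a x : s (a *: x) = a * s x.
  wlog a0 : a / 0 <= a => [hw|].
    have [/hw//|a0] := leP 0 a.
    have := hw (- a); rewrite oppr_ge0 (ltW a0) => /(_ isT).
    by rewrite scaleNr sN mulNr => /oppr_inj.
  apply/eqP; rewrite eq_le ss.2//=.
  have := ss.2 a (- x) a0; rewrite scalerN !sN mulrN; lra.
have sl : linear (s : V -> R^o) by move=> a x y; rewrite sD sZ.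
pose F := GRing.isLinear.Build R V R^o *:%R (s : V -> R^o) sl.
exists (HB.pack (s : V -> R^o) F : {linear V -> R^o}); split=> [x|a Ka] /=.
  by apply: le_trans (sle x) _; exact: cone_inf_id.
rewrite -lerN2 -sN; apply: le_trans (sle _) _; exact: cone_inf_opp.
Qed.

(** The constraints [t * p y <= f (t *: y)] along the ray of [y] force equality at [y]. *)
Lemma hahn_banach_point p y : sublinear p ->
  exists f : {linear V -> R^o}, (forall x, f x <= p x) /\ f y = p y.
Proof.
move=> sp.
pose K := [set (t *: y, t * p y) | t in [set t : R | 0 <= t]].
have [| |f [fp fK]] := @mazur_orlicz p K sp.
- split; first by exists 0 => //=; rewrite scale0r mul0r.
    move=> _ _ [t t0 <-] [u u0 <-]; exists (t + u); first exact: addr_ge0.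
    by rewrite /= scalerDl mulrDl.
  move=> t _ t0 [u u0 <-]; exists (t * u); first exact: mulr_ge0.
  by rewrite /= scalerA mulrA.
- move=> _ [t t0 <-] /=; have [->|tn0] := eqVneq t 0.
    by rewrite mul0r scale0r sublinear0.
  have tp : 0 < t by rewrite lt_neqAle eq_sym tn0.
  rewrite -ler_pdivlMl//.
  have := sp.2 t^-1 (t *: y); rewrite scalerA mulVf// scale1r; apply.
  by rewrite invr_ge0.
exists f; split=> //; apply/eqP; rewrite eq_le fp/=.
have := fK (1 *: y, 1 * p y); rewrite /= scale1r mul1r; apply.
by exists 1; rewrite /= ?ler01 ?scale1r ?mul1r.
Qed.

End HahnBanach.

(** * Dual spaces and duality between convexity and smoothness *)

Section DualTheory.
Context {R : realType} {V : normedModType R}.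
Implicit Types (f g : dual V) (x y : V).

Lemma dual0 f : f 0 = 0. Proof. exact: linear0. Qed.

Lemma dualN f x : f (- x) = - f x. Proof. exact: linearN. Qed.

Lemma dualD f x y : f (x + y) = f x + f y. Proof. exact: linearD. Qed.

Lemma dualB f x y : f (x - y) = f x - f y. Proof. exact: linearB. Qed.

Lemma dualZ f (a : R) x : f (a *: x) = a * f x. Proof. exact: linearZ. Qed.

Lemma dual_sum f (I : Type) (r : seq I) (P : pred I) (F : I -> V) :
  f (\sum_(i <- r | P i) F i) = \sum_(i <- r | P i) f (F i).
Proof. exact: linear_sum. Qed.

Lemma dual_addE f g x : (f + g) x = f x + g x. Proof. by []. Qed.

Lemma dual_oppE f x : (- f) x = - f x. Proof. by []. Qed.

Lemma dual_subE f g x : (f - g) x = f x - g x. Proof. by []. Qed.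

Lemma dual_scaleE (a : R) f x : (a *: f) x = a * f x. Proof. by []. Qed.

Lemma dual_ex (f : V -> R^o) (C : R) : linear f ->
  (forall x, `|f x| <= C * `|x|) -> exists g : dual V, g =1 f.
Proof.
move=> fl fC; pose F := GRing.isLinear.Build R V R^o *:%R f fl.
have fc : continuous f.
  apply/(linear_bounded_continuous (HB.pack f F : {linear V -> R^o})).
  apply/linear_boundedP; exists C; split=> [|r Cr x]; first exact: num_real.
  by apply: le_trans (fC x) _; apply: ler_wpM2r => //; exact: ltW.
have fd : f \in @cont_linear R V by exact/mem_set.
by exists (Dual fd).
Qed.

Lemma dual_apply_le f x : `|f x| <= `|f| * `|x|.
Proof.
have [->|x0] := eqVneq x 0; first by rewrite linear0 !normr0 mulr0.
have nx : 0 < `|x| by rewrite normr_gt0.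
have : `|f (`|x|^-1 *: x)| <= `|f|.
  by apply: dual_norm_ub; rewrite normrZ normfV normr_id mulVf// gt_eqF.
by rewrite linearZ /= normrM normfV normr_id ler_pdivrMl// mulrC.
Qed.

Lemma dual_apply_ub f x : f x <= `|f| * `|x|.
Proof. exact: le_trans (ler_norm _) (dual_apply_le f x). Qed.

Lemma dual_norm_le_mul f (C : R) : 0 <= C ->
  (forall x, `|f x| <= C * `|x|) -> `|f| <= C.
Proof.
move=> C0 fC; apply: dual_norm_le => x x1; apply: le_trans (fC x) _.
by rewrite ler_piMr.
Qed.

Lemma dual_approx f (e : R) : 0 < e -> exists x, `|x| <= 1 /\ `|f| - e < f x.
Proof.
move=> e0; have [_ [x x1 <-] h] := sup_adherent e0 (dual_bounded f).
have [fx|fx] := leP 0 (f x); first by exists x; rewrite ger0_norm// in h.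
exists (- x); rewrite normrN; split=> //.
by rewrite linearN /=; rewrite ltr0_norm in h.
Qed.

Lemma norm_sublinear : sublinear (fun y : V => `|y| : R).
Proof.
split=> [a b|t y t0]; first exact: ler_normD.
by rewrite normrZ ger0_norm.
Qed.

(** The bound is [<= 1] and not [= 1], so that [x = 0] is covered even in the zero space. *)
Lemma norming x : exists f, `|f| <= 1 /\ f x = `|x|.
Proof.
have [f [fle fx]] := hahn_banach_point x norm_sublinear.
have fb y : `|f y| <= 1 * `|y|.
  rewrite mul1r ler_norml fle andbT lerNl.
  by have := fle (- y); rewrite linearN normrN.
have [g gf] := dual_ex (linearP f) fb; exists g; rewrite gf; split=> //.
by apply: dual_norm_le_mul => // y; rewrite gf.
Qed.

Lemma strictly_convex_midpoint :
  (forall x y, `|x| = 1 -> `|y| = 1 -> `|x + y| = 2 -> x = y) ->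
  strictly_convex V.
Proof.
move=> h x y x1 y1 seg; apply: h => //.
have := seg 2^-1; have -> : 1 - 2^-1 = 2^-1 :> R by lra.
rewrite -scalerDr normrZ ger0_norm ?invr_ge0// => e.
have : 2^-1 * `|x + y| = 1 by apply: e; apply/andP; split; lra.
by lra.
Qed.

(* Test both functionals near a point almost norming for [f + g]. *)
Lemma dual_agree y f g : (forall e : R, 0 < e -> exists2 s : R, 0 < s &
    forall x, `|x| <= 1 -> `|x + s *: y| + `|x - s *: y| <= 2 + s * e) ->
  `|f| = 1 -> `|g| = 1 -> `|f + g| = 2 -> f y = g y.
Proof.
move=> smooth_y.
suff le (h k : dual V) : `|h| = 1 -> `|k| = 1 -> `|h + k| = 2 -> h y <= k y.
  move=> f1 g1 fg; apply/eqP; rewrite eq_le le//= le// addrC//.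
move=> h1 k1 hk; apply/ler_addgt0Pr => e e0.
(* One half of [e] pays for the smoothness estimate, the other for choosing [x] almost norming for
   [h + k]. *)
have e20 : 0 < e / 2 by lra.
have [s s0 hs] := smooth_y _ e20.
have [x [x1]] := dual_approx (h + k) (mulr_gt0 s0 e20).
rewrite hk; have := hs x x1.
have := dual_apply_ub h (x + s *: y); have := dual_apply_ub k (x - s *: y).
rewrite h1 k1 !mul1r dualB dualD !dualZ => A B C.
rewrite dual_addE => D.
suff : s * h y <= s * (k y + e) by rewrite ler_pM2l.
by lra.
Qed.

End DualTheory.

(** * Transfer of convexity, smoothness and roughness between a space, its dual and its bidual *)

Section DualGeometry.
Context {R : realType} {V : normedModType R}.
Implicit Types (f g : dual V) (x y : V).

(* [G] and [H] are almost attained at points of a thin slice, on which [v]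
   is almost constant; perturbing the slicing functional by [s v] compares
   [G v] and [H v] with values of [v] on the slice. *)
Lemma bidual_agree (v : dual V) (G H : dual (dual V)) :
  (forall e : R, 0 < e -> exists2 d : R, 0 < d & forall x y,
     `|x| <= 1 -> `|y| <= 1 -> 2 - d < `|x + y| -> `|v x - v y| <= e) ->
  `|G| = 1 -> `|H| = 1 -> `|G + H| = 2 -> G v = H v.
Proof.
move=> uc.
suff le (G' H' : dual (dual V)) : `|G'| = 1 -> `|H'| = 1 -> `|G' + H'| = 2 ->
    G' v <= H' v.
  move=> G1 H1 GH; apply/eqP; rewrite eq_le le//= le// addrC//.
move=> {G H} G1 H1 GH; apply/ler_addgt0Pr => e e0.
have e50 : 0 < e / 5 by lra.
have [d d0 hd] := uc _ e50.
pose C := 2 * `|v| + e / 5 + 1.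
have v0 : 0 <= `|v| by [].
have C0 : 0 < C by rewrite /C; lra.
pose s := d / (4 * C).
have s0 : 0 < s by rewrite /s divr_gt0// mulr_gt0.
have sC : s * C = d / 4.
  by rewrite /s; field; rewrite gt_eqF.
pose eta := Num.min (d / 4) (s * (e / 5)).
have eta0 : 0 < eta by rewrite lt_min divr_gt0//= mulr_gt0.
have etad : eta <= d / 4 by rewrite ge_min lexx.
have etas : eta <= s * (e / 5) by rewrite ge_min lexx orbT.
have [f [f1]] := dual_approx (G' + H') eta0.
rewrite GH dual_addE => fGH.
have se : 0 < s * (e / 5) by rewrite mulr_gt0.
have [x [x1 fx]] := dual_approx (f + s *: v) se.
have [y [y1 fy]] := dual_approx (f - s *: v) se.
have := dual_apply_ub G' (f + s *: v); have := dual_apply_ub H' (f - s *: v).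
rewrite G1 H1 !mul1r dualB dualD !dualZ => A B.
have Gf : G' f <= 1.
  by apply: le_trans (dual_apply_ub _ _) _; rewrite G1 mul1r.
have Hf : H' f <= 1.
  by apply: le_trans (dual_apply_ub _ _) _; rewrite H1 mul1r.
have Gv : `|G' v| <= `|v|.
  by apply: le_trans (dual_apply_le _ _) _; rewrite G1 mul1r.
have Hv : `|H' v| <= `|v|.
  by apply: le_trans (dual_apply_le _ _) _; rewrite H1 mul1r.
have le1 z : `|z| <= 1 -> `|v z| <= `|v|.
  by move=> z1; apply: le_trans (dual_apply_le _ _) _; rewrite ler_piMr.
have le1f z : `|z| <= 1 -> f z <= 1.
  move=> z1; apply: le_trans (dual_apply_ub _ _) _.
  by apply: mulr_ile1.
move: fx fy; rewrite dual_subE dual_addE !dual_scaleE => fx fy.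
have sv (a : R) : `|a| <= `|v| -> - (s * `|v|) <= s * a <= s * `|v|.
  by move=> av; rewrite -ler_norml normrM gtr0_norm// ler_pM2l.
have /andP[a1 a2] := sv _ Gv; have /andP[b1 b2] := sv _ Hv.
have /andP[c1 c2] := sv _ (le1 _ x1); have /andP[d1 d2] := sv _ (le1 _ y1).
have sC' : s * `|v| * 2 + s * (e / 5) + s = d / 4 by rewrite -sC /C; ring.
have xy : 2 - d < `|x + y|.
  have : f (x + y) <= `|x + y|.
    apply: le_trans (dual_apply_ub _ _) _; rewrite -[leRHS]mul1r.
    by rewrite ler_wpM2r.
  rewrite dualD; lra.
have := hd x y x1 y1 xy; rewrite ler_norml => /andP[_ vxy].
have svxy : s * (v x - v y) <= s * (e / 5) by rewrite ler_pM2l.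
have := le1f _ x1; have := le1f _ y1 => fy1 fx1.
suff : s * G' v <= s * (H' v + e) by rewrite ler_pM2l.
lra.
Qed.

(* The one-sided derivative of the norm at [x] in the direction [h] is
   [inf_(t >= 0) (`|h + t x| - t `|x|)], a sublinear function of [h]; each of its
   values is taken by a norming functional of [x], which is unique. *)
Lemma smooth_of_dual : strictly_convex (dual V) -> smooth V.
Proof.
move=> sc x x0.
have nx : 0 < `|x| by rewrite normr_gt0.
have sn := norm_sublinear.
pose K : set (V * R) := [set (t *: x, t * `|x|) | t in [set t : R | 0 <= t]].
have cK : cone K.
  split; first by exists 0 => //=; rewrite scale0r mul0r.
    move=> _ _ [t t0 <-] [u u0 <-]; exists (t + u); first exact: addr_ge0.
    by rewrite /= scalerDl mulrDl.
  move=> t _ t0 [u u0 <-]; exists (t * u); first exact: mulr_ge0.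
  by rewrite /= scalerA mulrA.
have Kn a : K a -> a.2 <= `|a.1|.
  by move=> [t t0 <-] /=; rewrite normrZ ger0_norm.
pose D := cone_inf (fun y : V => `|y| : R) K.
have sD : sublinear D by exact: cone_inf_sublinear.
have Dn h : D h <= `|h| by exact: cone_inf_id.
have Kx : K (x, `|x|) by exists 1; rewrite /= ?scale1r ?mul1r ?ler01.
have Dx : D (- x) <= - `|x| by exact: cone_inf_opp Kx.
(* A functional below [D] has norm at most one, and the value of [D] at [- x] makes it norm [x];
   Hahn-Banach provides one with the value [D h] at [h]. *)
have ex h : exists f, [/\ `|f| = 1, f x = `|x| & f h = D h].
  have [l [lD lh]] := hahn_banach_point h sD.
  have ln y : l y <= `|y| by exact: le_trans (lD y) (Dn y).
  have lb y : `|l y| <= 1 * `|y|.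
    rewrite mul1r ler_norml ln andbT lerNl.
    by have := ln (- y); rewrite linearN normrN.
  have [f fl] := dual_ex (linearP l) lb; exists f; rewrite !fl.
  have lx : l x = `|x|.
    apply/eqP; rewrite eq_le ln/=.
    by have := le_trans (lD _) Dx; rewrite linearN lerN2.
  split=> //; apply/eqP; rewrite eq_le; apply/andP; split.
    by apply: dual_norm_le_mul => // y; rewrite fl.
  by have := dual_apply_ub f x; rewrite fl lx ler_pMl.
have [f0 [f01 f0x _]] := ex x.
have f0D h : f0 h = D h.
  have [f [f1 fx <-]] := ex h.
  (* Evaluation at [x] shows that the segment between two norming functionals of [x] lies on the
     dual sphere. *)
  suff -> : f0 = f by [].
  apply: sc => // t /andP[t0 t1].
  have t1' : 0 <= 1 - t by rewrite subr_ge0.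
  apply/eqP; rewrite eq_le; apply/andP; split.
    apply: le_trans (ler_normD _ _) _.
    by rewrite !normrZ f01 f1 !ger0_norm// !mulr1 subrK.
  have := dual_apply_ub ((1 - t) *: f0 + t *: f) x.
  rewrite dual_addE !dual_scaleE f0x fx -mulrDl subrK mul1r.
  by rewrite ler_pMl.
have ray (h : V) (t u : R) : 0 <= t -> t <= u ->
    `|h + u *: x| - u * `|x| <= `|h + t *: x| - t * `|x|.
  move=> t0 tu; have -> : h + u *: x = (h + t *: x) + (u - t) *: x.
    by rewrite -addrA -scalerDl (addrC t) subrK.
  have := ler_normD (h + t *: x) ((u - t) *: x).
  by rewrite normrZ ger0_norm ?subr_ge0//; lra.
(* The difference quotient with step [s] is the expression under the infimum at [t = s^-1]. That
   expression is nonincreasing in [t] by [ray], so [s^-1] only has to exceed one nearly optimal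
   [t]. *)
have quot (h : V) (e : R) : 0 < e -> exists2 d : R, 0 < d &
    forall s : R, 0 < s -> s < d ->
      f0 h <= s^-1 * (`|s *: h + x| - `|x|) <= f0 h + e.
  move=> e0.
  have [t [t0 ht]] : exists t, 0 <= t /\ `|h + t *: x| - t * `|x| < f0 h + e.
    have [b hb] : has_inf [set (`|h + a.1| : R) - a.2 | a in K].
      split; first by exists (`|h + x| - `|x|), (x, `|x|).
      exists (- `|h|) => _ [a Ka <-]; have := Kn a Ka.
      have := ler_normD (h + a.1) (- h); rewrite addrAC subrr add0r normrN; lra.
    have [_ [_ [t t0 <-] <-] lt] := inf_adherent e0 (conj b hb).
    by exists t; split=> //; rewrite f0D.
  exists (t + 1)^-1 => [|s s0 sd]; first by rewrite invr_gt0 ltr_wpDl.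
  have ts : t <= s^-1.
    rewrite ltW// (lt_trans (ltr_pwDr ltr01 (lexx t)))//.
    by rewrite -[t + 1]invrK ltf_pV2// posrE ?invr_gt0 ltr_wpDl.
  have -> : s^-1 * (`|s *: h + x| - `|x|) = `|h + s^-1 *: x| - s^-1 * `|x|.
    rewrite mulrBr; congr (_ - _).
    have -> : h + s^-1 *: x = s^-1 *: (s *: h + x).
      by rewrite scalerDr scalerA mulVf ?gt_eqF// scale1r.
    by rewrite normrZ gtr0_norm// invr_gt0.
  apply/andP; split; last exact: le_trans (ray h _ _ t0 ts) (ltW ht).
  have := dual_apply_ub f0 (h + s^-1 *: x).
  by rewrite dualD dualZ f01 f0x mul1r; lra.
exists f0 => h.
suff lim : (s^-1 *: ((((fun z : V => `|z| : R^o) \o shift x) (s *: h) - `|x|) : R^o))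
    @[s --> 0^'] --> (f0 h : R^o).
  by apply: DeriveDef; [apply/cvg_ex; exists (f0 h)|exact/cvg_lim].
apply/cvgrPdist_le => e e0.
have [d d0 hd] := quot h e e0; have [d' d'0 hd'] := quot (- h) e e0.
have m0 : 0 < Num.min d d' by rewrite lt_min d0.
exists (Num.min d d') => //= s; rewrite /= sub0r normrN lt_min => /andP[sd sd'] s0.
rewrite /shift /= -[X in `|X|]/(f0 h - s^-1 * (`|s *: h + x| - `|x|)).
have [sp|sn0] := ltP 0 s.
  rewrite gtr0_norm// in sd; have /andP[a b] := hd s sp sd.
  by rewrite ler_norml; apply/andP; split; lra.
(* For [s < 0] the quotient is minus the one in direction [- h]; linearity of [f0] makes the two
   one-sided derivatives agree. *)
have sn' : 0 < - s by rewrite oppr_gt0 lt_neqAle s0.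
rewrite ler0_norm// in sd'; have /andP[] := hd' (- s) sn' sd'.
rewrite scaleNr scalerN opprK dualN invrN mulNr => a b.
by rewrite ler_norml; apply/andP; split; lra.
Qed.

(** If [x], [y] lie in a slice of [f] and [h] norms [x - y], evaluating [f + t h] at [x] and
    [f - t h] at [y] bounds the sum of their norms below by twice the norm of [f] plus [t r], up to
    twice the depth of the slice. At [f = 0] the quotient is [2], which is where [r <= 2] and a
    nonzero functional enter. *)
Lemma rough_of_slices (r : R) : r <= 2 -> (exists f, f != 0) ->
  (forall f (a : R), f != 0 -> 0 < a -> exists x y,
     [/\ `|x| <= 1, `|y| <= 1, `|f| - a < f x, `|f| - a < f y & r <= `|x - y|]) ->
  rough (dual V) r.
Proof.
move=> r2 [g0 g00] slices f.
(* The limsup is an infimum of suprema over punctured neighbourhoods, so each neighbourhood must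
   contain a direction [h] with quotient at least [r - e]. *)
apply/le_ereal_inf_tmp => _ [A nA <-]; apply/lee_addgt0Pr => e e0.
suff [h Ah hr] : exists2 h, A h & r - e <= (`|f + h| + `|f - h| - 2 * `|f|) / `|h|.
  rewrite -leeBlDr//.
  apply: le_trans (ereal_sup_ubound _); last by exists h.
  by rewrite -EFinB lee_fin.
have /nbhs_normP[d /= d0 dA] : nbhs (0 : dual V) (fun h => h != 0 -> A h) by exact: nA.
have unit (g : dual V) : g != 0 -> exists g', `|g'| = 1.
  move=> gn0; exists (`|g|^-1 *: g).
  by rewrite normrZ normfV normr_id mulVf// normr_eq0.
pose t := d / 2.
have t0 : 0 < t by rewrite divr_gt0.
have ball_t (h : dual V) : `|h| = t -> A h.
  move=> ht; apply: dA; last by rewrite -normr_gt0 ht.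
  by rewrite /ball_ /= sub0r normrN ht /t; lra.
have [->|f0] := eqVneq f 0.
  have [g g1] := unit _ g00; have ht : `|t *: g| = t.
    by rewrite normrZ g1 mulr1 gtr0_norm.
  exists (t *: g); first exact: ball_t.
  rewrite add0r sub0r normrN normr0 mulr0 subr0 ht ler_pdivlMr//.
  by rewrite -mulr2n -mulr_natl ler_pM2r//; lra.
have te : 0 < t * e / 2 by rewrite divr_gt0// mulr_gt0.
have [x [y [x1 y1 fx fy rxy]]] := slices f _ f0 te.
have [g [g1 gxy]] := norming (x - y).
(* For [x = y] the functional from [norming] need not have norm one; any functional of norm one
   serves then. *)
have [h [h1 hxy]] : exists h : dual V, `|h| = 1 /\ h (x - y) = `|x - y|.
  have [xy0|xyn0] := eqVneq (x - y) 0.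
    by have [h h1] := unit _ f0; exists h; rewrite xy0 dual0 normr0.
  exists g; split=> //; apply/eqP; rewrite eq_le g1/=.
  by have := dual_apply_ub g (x - y); rewrite gxy ler_pMl// normr_gt0.
have ht : `|t *: h| = t by rewrite normrZ h1 mulr1 gtr0_norm.
exists (t *: h); first exact: ball_t.
rewrite ht ler_pdivlMr//.
have le1 (k : dual V) z : `|z| <= 1 -> k z <= `|k|.
  by move=> z1; apply: le_trans (dual_apply_ub _ _) _; rewrite ler_piMr.
have := le1 (f + t *: h) x x1; have := le1 (f - t *: h) y y1.
rewrite dual_subE dual_addE !dual_scaleE => A1 A2.
have : t * r <= t * (h x - h y) by rewrite ler_pM2l// -dualB hxy.
lra.
Qed.

End DualGeometry.

(** * Complemented copies of c0 *)

(** The sequence inverts an injection of the dense set into [nat], with default value [0] outside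
    its image. *)
Lemma separable_seq {R : realType} {V : normedModType R} : separable V ->
  exists s : nat -> V, forall x (e : R), 0 < e -> exists n, `|x - s n| < e.
Proof.
move=> [S /countable_injP[f finj] dS].
have /choice[s hs] : forall n, exists y, forall x, S x -> f x = n -> y = x.
  move=> n; have [[x [Sx fx]]|nx] := pselect (exists x, S x /\ f x = n).
    by exists x => x' Sx' fx'; apply: finj; rewrite ?inE// fx.
  by exists 0 => x Sx fx; case: nx; exists x.
exists s => x e e0.
have [] := dS (ball x e); [by exists x; exact: ballxx|exact: ball_open|].
move=> y [xy Sy]; exists (f y); rewrite (hs _ _ Sy erefl).
by move: xy; rewrite -ball_normE.
Qed.

(** * Limits along an ultrafilter *)

Section UltraLimit.
Context {R : realType}.

(** Compactness of the segment gives a cluster point, and along an ultrafilter a cluster point is a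
    limit. *)
Lemma ultra_limit (G : set_system nat) (r : nat -> R) (B : R) :
  UltraFilter G -> (forall n, `|r n| <= B) ->
  exists l : R, forall e, 0 < e -> G [set n | `|r n - l| <= e].
Proof.
move=> uG rB; have pG : ProperFilter G by exact: ultra_proper.
have AG : G (r @^-1` `[- B, B]).
  by apply: (filterS _ filterT) => n _ /=; rewrite in_itv/= -ler_norml.
have [l [_ cl]] := @segment_compact R (- B) B _ (fmap_proper_filter r pG) AG.
exists l => e e0; have [//|nG] := in_ultra_setVsetC [set n | `|r n - l| <= e] uG.
have [||y [ny /= ly]] := cl [set y | ~ (`|y - l| <= e)] (ball l e).
- exact: nG.
- exact: nbhsx_ballx.
by case: ny; rewrite distrC ltW.
Qed.

End UltraLimit.

(** * Null sequences *)

Section C0.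
Context {R : realType}.

Lemma c0_ex (u : nat -> R) : u n @[n --> \oo] --> (0 : R^o) ->
  exists v : c0 R, v =1 u.
Proof.
move=> u0; have hu : (u : nat -> R^o) \in @vanishing R by exact/mem_set.
by exists (CZero hu).
Qed.

Lemma c0_cvg (u : c0 R) : u n @[n --> \oo] --> (0 : R^o).
Proof. by case: u => u /= /set_mem. Qed.

Lemma c0_near (u : c0 R) (e : R) : 0 < e ->
  exists N, forall n, (N <= n)%N -> `|u n| <= e.
Proof.
move=> e0; have /cvgrPdist_le/(_ e e0)[N _ hN] := c0_cvg u.
by exists N => n Nn; have := hN n Nn; rewrite /= sub0r normrN.
Qed.

Lemma c0_exP (u : nat -> R) :
  (forall e, 0 < e -> exists N, forall n, (N <= n)%N -> `|u n| <= e) ->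
  exists v : c0 R, v =1 u.
Proof.
move=> h; apply: c0_ex; apply/cvgrPdist_le => e e0; have [N hN] := h e e0.
by exists N => // n Nn; rewrite /= sub0r normrN; exact: hN.
Qed.

Lemma c0P (u v : c0 R) : (u =1 v) -> u = v.
Proof. by move=> uv; apply/val_inj/funext. Qed.

Lemma c0_unit (n : nat) : exists v : c0 R, forall i, v i = (i == n)%:R.
Proof.
apply: c0_exP => e e0; exists n.+1 => i ni.
by rewrite gtn_eqF// normr0 ltW.
Qed.

Lemma c0_normE (u : c0 R) n : `|u n| <= `|u|.
Proof. exact: c0_norm_ub. Qed.

Lemma c0_spread (iota : nat -> nat) :
  {homo iota : i j / (i < j)%N} ->
  exists S : {linear c0 R -> c0 R}, [/\ (forall u, `|S u| <= `|u|),
    (forall u i, S u (iota i) = u i) &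
    (forall u n, (forall i, iota i <> n) -> S u n = 0)].
Proof.
move=> iotaS.
have iota_ge i : (i <= iota i)%N.
  by elim: i => // i ih; rewrite (leq_ltn_trans ih)// iotaS.
have iota_inj : injective iota.
  move=> i j; have [ij|ij|//] := ltngtP i j.
    by move=> e; have := iotaS _ _ ij; rewrite e ltnn.
  by move=> e; have := iotaS _ _ ij; rewrite e ltnn.
(* At most one index is selected, and [iota_ge] keeps it within the range of the sum. *)
pose sp (u : nat -> R) n : R := \sum_(i < n.+1 | iota i == n) u i.
have sp_iota u i : sp u (iota i) = u i.
  have lt : (i < (iota i).+1)%N by rewrite ltnS.
  rewrite /sp (big_pred1 (Ordinal lt))// => j /=.
  by rewrite (inj_eq iota_inj).
have sp_out u n : (forall i, iota i <> n) -> sp u n = 0.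
  by move=> h; rewrite /sp big_pred0// => j; apply/eqP.
have /choice[S hS] : forall u : c0 R, exists v : c0 R, v =1 sp u.
  move=> u; apply: c0_exP => e e0; have [N hN] := c0_near u e0.
  exists (iota N) => n Nn.
  have [[i ni]|h] := pselect (exists i, iota i = n); last first.
    by rewrite sp_out ?normr0 1?ltW// => i hi; apply: h; exists i.
  subst n; rewrite sp_iota; apply: hN; rewrite leqNgt; apply/negP => iN.
  by have := iotaS _ _ iN; rewrite ltnNge Nn.
have Sl : linear S.
  move=> a u v; apply: c0P => n; rewrite hS.
  rewrite -[RHS]/(a * S u n + S v n) !hS /sp mulr_sumr -big_split.
  by [].
pose F := GRing.isLinear.Build R (c0 R) (c0 R) *:%R S Sl.
exists (HB.pack S F : {linear c0 R -> c0 R}); split=> [u|u i|u n h] /=.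
- apply: c0_norm_le => n; rewrite hS.
  have [[i <-]|h] := pselect (exists i, iota i = n); last first.
    by rewrite sp_out ?normr0// => i hi; apply: h; exists i.
  by rewrite sp_iota; exact: c0_normE.
- by rewrite hS.
- by rewrite hS sp_out.
Qed.

End C0.

(** * Sobczyk's theorem for a subsequence of the unit vectors *)

Section Sobczyk.
Context {R : realType}.

Lemma exp_half_small (e : R) : 0 < e ->
  exists N, forall n, (N <= n)%N -> 2^-1 ^+ n <= e.
Proof.
move=> e0; have : (2^-1 : R) ^+ n @[n --> \oo] --> (0 : R^o).
  by apply: cvg_expr; rewrite ger0_norm ?invr_ge0// invf_lt1// ltr1n.
move/cvgrPdist_le => /(_ e e0)[N _ hN].
exists N => n Nn; have := hN n Nn; rewrite /= sub0r normrN.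
exact: le_trans (ler_norm _).
Qed.

Lemma filter_forall_le (T : Type) (G : set_system T) (P : nat -> set T) k :
  Filter G -> (forall j, G (P j)) -> G [set n | forall j, (j <= k)%N -> P j n].
Proof.
move=> fG GP; elim: k => [|k ih].
  by apply: filterS (GP 0%N) => n Pn j; rewrite leqn0 => /eqP ->.
apply: filterS (filterI ih (GP k.+1)) => n [h1 h2] j.
by rewrite leq_eqVlt => /orP[/eqP ->|]//; rewrite ltnS; exact: h1.
Qed.

Context {X : normedModType R} (J : {linear c0 R -> X}) (m M : R).
Hypotheses (m0 : 0 < m) (Jm : forall u, m * `|u| <= `|J u| <= M * `|u|).

Lemma embedding_bound_ge0 : 0 <= M.
Proof.
have [d dE] := @c0_unit R 0; have /andP[h1 h2] := Jm d.
have d0 : 0 < `|d| by rewrite (lt_le_trans _ (c0_normE d 0%N))// dE normr1.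
rewrite -(pmulr_lge0 _ d0); apply: le_trans (le_trans h1 h2).
by rewrite mulr_ge0// ltW.
Qed.

(** Hahn-Banach extension of a coordinate from the range of [J]. The graph [K] is a linear subspace,
    so its constraints hold with equality. *)
Lemma coordinate_ex n : exists g : dual X,
  (forall u, g (J u) = u n) /\ forall x, `|g x| <= m^-1 * `|x|.
Proof.
pose p (x : X) := m^-1 * `|x|.
have im : 0 <= m^-1 by rewrite invr_ge0 ltW.
have sp : sublinear p.
  split=> [x y|t x t0]; first by rewrite /p -mulrDr ler_wpM2l// ler_normD.
  by rewrite /p normrZ ger0_norm// mulrCA.
pose K : set (X * R) := [set (J u, u n) | u in [set: c0 R]].
have [||f [fp fK]] := @mazur_orlicz R X p K sp.
- split.
  + by exists 0; rewrite ?linear0.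
  + by move=> _ _ [u _ <-] [v _ <-]; exists (u + v); rewrite ?linearD.
  + by move=> t _ t0 [u _ <-]; exists (t *: u); rewrite ?linearZ.
- move=> _ [u _ <-] /=; apply: le_trans (ler_norm _) _.
  apply: le_trans (c0_normE _ _) _; rewrite /p ler_pdivlMl//.
  by have /andP[] := Jm u.
have fb x : `|f x| <= m^-1 * `|x|.
  rewrite ler_norml fp andbT lerNl.
  by have := fp (- x); rewrite linearN /p normrN.
have [g gf] := dual_ex (linearP f) fb; exists g; split=> [u|x]; rewrite gf//.
apply/eqP; rewrite eq_le; apply/andP; split; last first.
  by have := fK (J u, u n); apply; exists u.
have := fK (J (- u), (- u) n); rewrite /= !linearN => h.
by have := h _; rewrite lerN2; apply; exists (- u); rewrite ?linearN.
Qed.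

(** Testing [f] on the image of a finite sequence of signs bounds the partial sums of the [a n]; a
    convergent series has null terms. *)
Lemma c0_embed_weakly_null (f : dual X) (d : nat -> c0 R) :
  (forall n i, d n i = (i == n)%:R) -> forall e, 0 < e ->
  exists N, forall n, (N <= n)%N -> `|f (J (d n))| <= e.
Proof.
move=> dE e e0; pose a n : R := `|f (J (d n))|.
have bnd K : \sum_(0 <= n < K) a n <= `|f| * M.
  pose u : c0 R := \sum_(0 <= n < K) Num.sg (f (J (d n))) *: d n.
  have uE i : u i = if (i < K)%N then Num.sg (f (J (d i))) else 0.
    rewrite /u; elim: K {u} => [|K ih]; first by rewrite big_geq.
    rewrite big_nat_recr//=.
    rewrite -[LHS]/((\sum_(0 <= n < K) Num.sg (f (J (d n))) *: d n : c0 R) i +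
      Num.sg (f (J (d K))) * d K i) ih dE.
    rewrite ltnS (leq_eqVlt i K).
    have [->|iK] := eqVneq i K; first by rewrite ltnn mulr1 add0r.
    by rewrite mulr0 addr0.
  have fu : f (J u) = \sum_(0 <= n < K) a n.
    rewrite /u linear_sum dual_sum; apply: eq_bigr => n _.
    have -> : J (Num.sg (f (J (d n))) *: d n) = Num.sg (f (J (d n))) *: J (d n).
      exact: linearZ.
    by rewrite dualZ -normrEsg.
  have u1 : `|u| <= 1.
    apply: c0_norm_le => n; rewrite uE; case: ifP => _; rewrite ?normr0//.
    by rewrite normr_sg; case: (_ == 0).
  rewrite -fu; apply: le_trans (dual_apply_ub _ _) _.
  rewrite ler_wpM2l//; have /andP[mJ JM] := Jm u; apply: le_trans JM _.
  by rewrite ler_piMr// embedding_bound_ge0.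
have : cvgn (series a).
  apply: nondecreasing_is_cvgn.
    move=> n k nk; apply: (nondecreasing_series (P := xpredT) _ nk) => i _ _.
    by rewrite /a.
  by exists (`|f| * M) => _ [n _ <-]; exact: bnd.
move=> /cvg_series_cvg_0/cvgrPdist_le => /(_ e e0)[N _ hN].
by exists N => n Nn; have := hN n Nn; rewrite /= sub0r normrN normr_id.
Qed.

(** The limit [l] of the extended coordinates [g n] along an ultrafilter vanishes on the range of
    [J], so the [h n = g n - l] still extend the coordinates and tend to [0] along the ultrafilter
    at every point. A diagonal subsequence [io] tends to [0] on a dense sequence, hence everywhere:
    this is [T]. Then [P] puts the coordinates back into the copy of [c0]. *)
Lemma c0_projection (xs : nat -> X) (fs : nat -> dual X) :
  (forall x (e : R), 0 < e -> exists n, `|x - xs n| < e) ->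
  exists (e : nat -> X) (T : {linear X -> c0 R}) (P : {linear X -> X}) (C : R),
  [/\ 0 < C, (forall x, `|T x| <= C * `|x|) /\ (forall x, `|P x| <= C * `|T x|),
      (forall i, P (e i) = e i) /\ (forall i j, T (e i) j = (j == i)%:R),
      (forall j i, (j <= i)%N -> `|fs j (e i)| <= 2^-1 ^+ (i * i)) &
      (forall (f : dual X) (eps : R), 0 < eps ->
         exists N, forall n, (N <= n)%N -> `|f (e n)| <= eps)].
Proof.
move=> dxs.
have [d dE] := choice (@c0_unit R).
have [g gP] := choice coordinate_ex.
have gJ n u : g n (J u) = u n by case: (gP n).
have gb n x : `|g n x| <= m^-1 * `|x| by case: (gP n).
have [G [uG ooG]] := @ultraFilterLemma nat \oo _.
have pG : ProperFilter G by exact: ultra_proper.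
have [l lP] := choice (fun x => ultra_limit (r := fun n => g n x) uG (fun n => gb n x)).
have l_uniq x y (c : R) : 0 <= c ->
    (forall e, 0 < e -> G [set n | `|g n x - y| <= c * e]) -> l x = y.
  move=> c0 h; apply/eqP; rewrite -subr_eq0 -normr_eq0 eq_le normr_ge0 andbT.
  apply/ler_addgt0Pr => e e0; rewrite add0r.
  have e1 : 0 < e / (c + 1) by rewrite divr_gt0// ltr_wpDl.
  have [n [/= n1 n2]] := filter_ex (filterI (h _ e1) (lP x _ e1)).
  have -> : l x - y = (g n x - y) - (g n x - l x) by ring.
  apply: le_trans (ler_normB _ _) _; apply: le_trans (lerD n1 n2) _.
  by rewrite -[X in _ + X]mul1r -mulrDl mulrCA divff ?mulr1// gt_eqF// ltr_wpDl.
have l_lin a x y : l (a *: x + y) = a * l x + l y.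
  apply: (@l_uniq _ _ (`|a| + 1)) => [|e e0]; first by rewrite addr_ge0.
  apply: filterS (filterI (lP x e e0) (lP y e e0)) => n [/= nx ny].
  rewrite dualD dualZ.
  have -> : a * g n x + g n y - (a * l x + l y) =
    a * (g n x - l x) + (g n y - l y) by ring.
  apply: le_trans (ler_normD _ _) _; rewrite normrM mulrDl mul1r lerD//.
  by rewrite ler_wpM2l.
have lJ u : l (J u) = 0.
  apply: (@l_uniq _ _ 1) => // e e0.
  have [N hN] := c0_near u e0.
  apply: ooG; exists N => // n Nn.
  by rewrite /= subr0 gJ mul1r; exact: hN.
have lb x : `|l x| <= m^-1 * `|x|.
  apply/ler_addgt0Pr => e e0; have [n /= ne] := filter_ex (lP x e e0).
  have -> : l x = g n x - (g n x - l x) by ring.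
  by apply: le_trans (ler_normB _ _) _; rewrite lerD.
pose h n x : R := g n x - l x.
have h_lin n a x y : h n (a *: x + y) = a * h n x + h n y.
  by rewrite /h dualD dualZ l_lin; ring.
have hB n x y : h n x - h n y = h n (x - y).
  have -> : x - y = -1 *: y + x by rewrite scaleN1r addrC.
  by rewrite h_lin; ring.
have hb n x : `|h n x| <= 2 * m^-1 * `|x|.
  apply: le_trans (ler_normB _ _) _.
  by have := gb n x; have := lb x; lra.
(* Each condition holds on a set of the ultrafilter, so finitely many hold at a common index; the
   one on [fs] holds for all large [n] since [J (d n)] is weakly null. *)
have sel k N : exists n, [/\ (N < n)%N,
    forall j, (j <= k)%N -> `|h n (xs j)| <= 2^-1 ^+ k &
    forall j, (j <= k)%N -> `|fs j (J (d n))| <= 2^-1 ^+ (k * k)].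
  have p0 i : 0 < (2^-1 : R) ^+ i by rewrite exprn_gt0// invr_gt0.
  have G1 : G [set n | forall j, (j <= k)%N -> `|h n (xs j)| <= 2^-1 ^+ k].
    by apply: filter_forall_le => j; exact: lP.
  have G2 : G [set n | forall j, (j <= k)%N ->
      `|fs j (J (d n))| <= 2^-1 ^+ (k * k)].
    apply: (@filter_forall_le _ _ (fun j n => `|fs j (J (d n))| <= 2^-1 ^+ (k * k))) => j.
    have [N' hN'] := c0_embed_weakly_null (fs j) dE (p0 (k * k)%N).
    by apply: ooG; exists N' => // n; exact: hN'.
  have G3 : G [set n | (N < n)%N] by apply: ooG; exists N.+1.
  have [n [[n1 n2] n3]] := filter_ex (filterI (filterI G1 G2) G3).
  by exists n.
have [nx nxP] := choice (fun kN : nat * nat => sel kN.1 kN.2).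
pose io := fix io k := if k is k'.+1 then nx (k, io k') else nx (0, 0).
have io_S k : (io k < io k.+1)%N by have [] := nxP (k.+1, io k).
have io_lt : {homo io : i j / (i < j)%N}.
  apply: (@homo_ltn _ io (fun a b => (a < b)%N)) => // a b c.
  exact: ltn_trans.
have ioP k : (forall j, (j <= k)%N -> `|h (io k) (xs j)| <= 2^-1 ^+ k) /\
    (forall j, (j <= k)%N -> `|fs j (J (d (io k)))| <= 2^-1 ^+ (k * k)).
  by case: k => [|k]; [have [] := nxP (0, 0)|have [] := nxP (k.+1, io k)].
have [S [Sb Sio Sout]] := @c0_spread R _ io_lt.
have /choice[T TE] : forall x, exists v : c0 R, v =1 (fun i => h (io i) x).
  move=> x; apply: c0_exP => e e0.
  (* By [hb] a displacement of this size changes [h n] by at most [e / 2]. *)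
  have e1 : 0 < e * m / 4 by rewrite divr_gt0// mulr_gt0.
  have [j xj] := dxs x _ e1.
  have e2 : 0 < e / 2 by rewrite divr_gt0.
  have [N hN] := exp_half_small e2.
  exists (maxn N j) => i; rewrite geq_max => /andP[Ni ji].
  have -> : h (io i) x = h (io i) (xs j) + h (io i) (x - xs j) by rewrite -hB; ring.
  apply: le_trans (ler_normD _ _) _.
  have := (ioP i).1 j ji; have := hN i Ni; have := hb (io i) (x - xs j).
  have : 2 * m^-1 * `|x - xs j| <= 2 * m^-1 * (e * m / 4).
    by rewrite ler_wpM2l ?mulr_ge0 ?invr_ge0 ?(ltW m0)// ltW.
  have -> : 2 * m^-1 * (e * m / 4) = e / 2 by field; rewrite gt_eqF.
  lra.
have Tl : linear T.
  by move=> a x y; apply: c0P => i; rewrite TE h_lin -!TE.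
have M0 := embedding_bound_ge0.
pose F := GRing.isLinear.Build R X (c0 R) *:%R T Tl.
pose Tl' : {linear X -> c0 R} := HB.pack T F.
have Td i j : T (J (d (io i))) j = (j == i)%:R.
  rewrite TE /h gJ lJ subr0 dE; congr (nat_of_bool _)%:R.
  by apply/eqP/eqP => [e|->//]; apply/eqP; rewrite eqn_leq; apply/andP; split;
     rewrite leqNgt; apply/negP => /io_lt; rewrite e ltnn.
have Sd i : S (T (J (d (io i)))) = d (io i).
  apply: c0P => n; rewrite dE; have [[j <-]|no] := pselect (exists j, io j = n).
    rewrite Sio Td; congr (nat_of_bool _)%:R.
    by apply/eqP/eqP => [->//|e]; apply/eqP; rewrite eqn_leq; apply/andP; split;
      rewrite leqNgt; apply/negP => /io_lt; rewrite e ltnn.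
  rewrite Sout => [|j ij]; last by apply: no; exists j.
  by have [e|//] := eqVneq n (io i); case: no; exists i.
have Jl : linear (J \o (S \o T)).
  by move=> a x y /=; rewrite Tl linearP linearP.
pose F' := GRing.isLinear.Build R X X *:%R (J \o (S \o T)) Jl.
exists (fun i => J (d (io i))), Tl', (HB.pack (J \o (S \o T)) F' : {linear X -> X}).
exists (2 * m^-1 + M); split.
- by rewrite ltr_pwDl// mulr_gt0// invr_gt0.
- split=> x /=.
    apply: c0_norm_le => i; rewrite TE; apply: le_trans (hb _ _) _.
    by rewrite ler_wpM2r// lerDl.
  have /andP[_ h1] := Jm (S (T x)); apply: le_trans h1 _.
  apply: le_trans (ler_wpM2l M0 (Sb _)) _.
  by rewrite ler_wpM2r// lerDr mulr_ge0// invr_ge0 ltW.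
- by split=> [i|i j] /=; rewrite ?Sd// Td.
- by move=> j i ji; exact: (ioP i).2.
- move=> f eps eps0; have [N hN] := c0_embed_weakly_null f dE eps0.
  exists N => n Nn; apply: hN; apply: leq_trans Nn _.
  by elim: n => // n ih; rewrite (leq_ltn_trans ih).
Qed.

End Sobczyk.

(** * Geometrically dominated series *)

Section GeometricSeries.
Context {R : realType}.
Implicit Types s : nat -> R.

Definition geometric_bound s (C : R) := forall k, `|s k| <= C * 2^-1 ^+ k.

Definition ssum s : R := limn (series s).

Lemma exp_half_gt0 n : 0 < (2^-1 : R) ^+ n.
Proof. by rewrite exprn_gt0// invr_gt0. Qed.

Lemma exp_half_ge0 n : 0 <= (2^-1 : R) ^+ n.
Proof. exact/ltW/exp_half_gt0. Qed.

Lemma exp_half_le n p : (p <= n)%N -> (2^-1 : R) ^+ n <= 2^-1 ^+ p.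
Proof.
by move=> pn; apply: ler_wiXn2l => //; rewrite ?invr_ge0// invf_le1// ler1n.
Qed.

Lemma exp_half_le1 n : (2^-1 : R) ^+ n <= 1.
Proof. by have := @exp_half_le n 0 isT; rewrite expr0. Qed.

Lemma geometric_bound_sum s C n : geometric_bound s C ->
  \sum_(0 <= k < n) `|s k| <= 2 * C.
Proof.
move=> sC; have C0 : 0 <= C.
  by have := sC 0%N; rewrite expr0 mulr1; apply: le_trans.
(* The exact partial sum of the geometric majorant makes the induction go through. *)
apply: (@le_trans _ _ (2 * C - 2 * C * 2^-1 ^+ n)); last first.
  by rewrite gerBl mulr_ge0 ?exp_half_ge0// mulr_ge0.
elim: n => [|n ih]; first by rewrite big_geq// expr0 mulr1 subrr.
rewrite big_nat_recr//=; have := sC n; rewrite exprS.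
have -> : 2 * C * (2^-1 * 2^-1 ^+ n) = C * 2^-1 ^+ n by field.
lra.
Qed.

Lemma geometric_bound_cvg s C : geometric_bound s C -> cvgn (series s).
Proof.
move=> sC; apply: normed_cvg; apply: nondecreasing_is_cvgn.
  by move=> n k nk; apply: (nondecreasing_series (P := xpredT) _ nk) => i _ _ /=.
exists (2 * C) => _ [n _ <-]; exact: geometric_bound_sum.
Qed.

Lemma ssum_bound s C : geometric_bound s C -> `|ssum s| <= 2 * C.
Proof.
move=> sC; have cs := geometric_bound_cvg sC.
have b n : `|series s n| <= 2 * C.
  by apply: le_trans (geometric_bound_sum n sC); exact: ler_norm_sum.
rewrite ler_norml; apply/andP; split.
  by apply: limr_ge => //; near=> n; have := b n; rewrite ler_norml => /andP[].
by apply: limr_le => //; near=> n; have := b n; rewrite ler_norml => /andP[].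
Unshelve. all: by end_near. Qed.

Lemma geometric_boundD s s' C C' : geometric_bound s C -> geometric_bound s' C' ->
  geometric_bound (fun k => s k + s' k) (C + C').
Proof.
move=> sC sC' k; rewrite mulrDl.
by apply: le_trans (ler_normD _ _) _; exact: lerD.
Qed.

Lemma geometric_boundZ (a : R) s C : geometric_bound s C ->
  geometric_bound (fun k => a * s k) (`|a| * C).
Proof. by move=> sC k; rewrite normrM -mulrA ler_wpM2l. Qed.

Lemma ssumD s s' C C' : geometric_bound s C -> geometric_bound s' C' ->
  ssum (fun k => s k + s' k) = ssum s + ssum s'.
Proof.
move=> sC sC'; rewrite /ssum -limD;
  [|exact: geometric_bound_cvg sC|exact: geometric_bound_cvg sC'].
by congr (limn _); apply/funext => n; rewrite /series/= big_split.
Qed.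

Lemma ssumZ (a : R) s C : geometric_bound s C ->
  ssum (fun k => a * s k) = a * ssum s.
Proof.
move=> sC; have cs := geometric_bound_cvg sC.
have -> : a * ssum s = a *: (ssum s : R^o) by [].
rewrite /ssum -limZl_tmp//.
by congr (limn _); apply/funext => n; rewrite /series/= -mulr_sumr.
Qed.

Lemma ssum_le s s' C C' : geometric_bound s C -> geometric_bound s' C' ->
  (forall k, s k <= s' k) -> ssum s <= ssum s'.
Proof.
move=> sC sC' ss'; apply: ler_lim.
- exact: geometric_bound_cvg sC.
- exact: geometric_bound_cvg sC'.
- by near=> n; rewrite /series/= ler_sum.
Unshelve. all: by end_near. Qed.

Lemma ssum_single n (c : R) : ssum (fun k => (k == n)%:R * c) = c.
Proof.
apply/cvg_lim => //; apply: cvg_near_cst; near=> k.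
have nk : (n < k)%N by near: k; exact: nbhs_infty_gt.
rewrite /series/= big_mkord (bigD1 (Ordinal nk))//= eqxx mul1r big1 ?addr0// => i.
by move=> /eqP ni; case: eqP => [e|_]; rewrite ?mul0r//; case: ni; apply/val_inj.
Unshelve. all: by end_near. Qed.

Lemma geometric_bound_single n (c : R) :
  geometric_bound (fun k => (k == n)%:R * c) (`|c| * 2 ^+ n).
Proof.
move=> k; case: eqP => [->|_]; last first.
  by rewrite mul0r normr0 !mulr_ge0// ?exp_half_ge0// exprn_ge0.
by rewrite mul1r -mulrA -exprMn divff// expr1n mulr1.
Qed.

Lemma ssum_ge_term s C n : geometric_bound s C -> (forall k, 0 <= s k) ->
  s n <= ssum s.
Proof.
move=> sC s0; rewrite -[leLHS](ssum_single n (s n)).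
apply: (ssum_le (geometric_bound_single n (s n)) sC) => k.
by case: eqP => [->|_]; rewrite ?mul1r ?mul0r.
Qed.

End GeometricSeries.

(** * An independent family of functionals *)

Section IndependentFamily.
Context {R : realType} {X : normedModType R}.
Context (b : X -> R) (m M : R) (e : nat -> X) (T : {linear X -> c0 R})
  (fs : nat -> dual X).
Hypotheses (m0 : 0 <= m).
Hypotheses (bm : forall x, `|x| <= m * b x) (bM : forall x, b x <= M * `|x|).
Hypotheses (b0 : forall x, 0 <= b x) (Tb : forall x, `|T x| <= b x).
Hypothesis Te : forall i j, T (e i) j = (j == i)%:R.
Hypothesis fse : forall j i, (j <= i)%N -> `|fs j (e i)| <= 2^-1 ^+ (i * i).

(** The countable group [G] generated by the [fs]; lists form a countable type, so its elements can
    be enumerated by [unpickle]. *)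
Definition int_comb (s : seq (nat * int)) : dual X :=
  \sum_(p <- s) p.2%:~R *: fs p.1.

Lemma int_comb_cat s s' : int_comb (s ++ s') = int_comb s + int_comb s'.
Proof. by rewrite /int_comb big_cat. Qed.

Lemma int_comb_opp s : exists s', int_comb s' = - int_comb s.
Proof.
exists [seq (p.1, - p.2) | p <- s]; rewrite /int_comb big_map -sumrN.
by apply: eq_bigr => p _; rewrite mulrNz scaleNr.
Qed.

Lemma int_comb1 j : int_comb [:: (j, 1)] = fs j.
Proof. by rewrite /int_comb big_seq1 mulr1z scale1r. Qed.

(** The hypothesis gives the decay of [fs j] only from [i = j] on; the finitely many earlier values
    go into the constant. The rate [2^-(i^2)] beats every [2^-((k+1)i)]. *)
Lemma int_comb_decay s : exists A, 0 <= A /\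
  forall i, `|int_comb s (e i)| <= A * 2^-1 ^+ (i * i).
Proof.
have fs_decay j : exists A, 0 <= A /\ forall i, `|fs j (e i)| <= A * 2^-1 ^+ (i * i).
  pose a i := `|fs j (e i)| / 2^-1 ^+ (i * i).
  have a0 i : 0 <= a i by rewrite divr_ge0// exp_half_ge0.
  exists (1 + \sum_(i < j) a i); split; first by rewrite addr_ge0// sumr_ge0.
  move=> i; have [ji|ij] := leqP j i.
    apply: le_trans (fse ji) _; rewrite ler_peMl ?exp_half_ge0// lerDl.
    by rewrite sumr_ge0.
  rewrite -ler_pdivrMr ?exp_half_gt0// -[leLHS]/(a i) (bigD1 (Ordinal ij))//=.
  by rewrite addrCA lerDl addr_ge0// sumr_ge0.
elim: s => [|p s [A [A0 hA]]].
  by exists 0; split=> // i; rewrite /int_comb big_nil mul0r normr0.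
have [B [B0 hB]] := fs_decay p.1.
exists (`|p.2%:~R| * B + A); split=> [|i]; first by rewrite addr_ge0// mulr_ge0.
rewrite /int_comb big_cons dual_addE dual_scaleE mulrDl.
apply: le_trans (ler_normD _ _) _; apply: lerD; last exact: hA.
by rewrite normrM -mulrA ler_wpM2l.
Qed.

(* The values [2^-((k+1)i)] on [e_i] make the family independent: each
   term dominates the following ones as [i] grows. *)
Lemma power_functional k : exists w : dual X,
  (forall x, `|w x| <= 2 * b x) /\ forall i, w (e i) = 2^-1 ^+ (k.+1 * i).
Proof.
pose s x i : R := 2^-1 ^+ (k.+1 * i) * T x i.
have sb x : geometric_bound (s x) (b x).
  move=> i; rewrite /s normrM ger0_norm ?exp_half_ge0// mulrC.
  apply: ler_pM; rewrite ?exp_half_ge0//.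
    by apply: le_trans (c0_normE _ _) (Tb x).
  by apply: exp_half_le; rewrite leq_pmull.
have sl : linear (fun x => ssum (s x) : R^o).
  move=> a x y /=.
  have -> : s (a *: x + y) = fun i => a * s x i + s y i.
    apply/funext => i; rewrite /s linearP.
    rewrite -[(a *: T x + T y) i]/(a * T x i + T y i); ring.
  by rewrite (ssumD (geometric_boundZ a (sb x)) (sb y)) (ssumZ a (sb x)).
have [|w wL] := dual_ex (C := 2 * M) sl.
  move=> x /=; apply: le_trans (ssum_bound (sb x)) _.
  by rewrite -mulrA ler_wpM2l.
exists w; split=> [x|i]; rewrite wL /=; first exact: ssum_bound.
rewrite -[RHS](ssum_single i); congr ssum; apply/funext => j.
by rewrite /s Te; case: eqP => [->|_]; rewrite ?mulr1 ?mul1r ?mulr0 ?mul0r.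
Qed.

(** [a k] is a multiple of [u k + 2^-k w k], where [u] lists every integer combination infinitely
    often. For large [k] the second term is small, which gives the approximation; on [e i] it
    dominates the first as [i] grows, which gives independence. *)
Lemma independent_family (d : R) : 0 < d -> d <= 1 -> exists a : nat -> dual X,
  [/\ (forall k x, `|a k x| <= d * 2^-1 ^+ k * b x),
      (forall k i, `|a k (e i)| <= 2 * 2^-1 ^+ k * 2^-1 ^+ i),
      (forall (c : nat -> R) (C : R), (forall k, `|c k| <= C) ->
        (exists N, forall i, (N <= i)%N -> ssum (fun k => c k * a k (e i)) = 0) ->
        forall k, c k = 0) &
      (forall s (eps : R), 0 < eps -> exists k (c : R),
        forall x, `|int_comb s x - c * a k x| <= eps * b x)].
Proof.
move=> d0 d1.
(* The exponent of [2] in [k] takes each value [p] infinitely often, for instance at every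
   [2^p * 3^N]. *)
pose u k := if unpickle (logn 2 k) is Some s then int_comb s else 0.
have u_inf s N : exists2 k, (N <= k)%N & u k = int_comb s.
  exists (2 ^ pickle s * 3 ^ N)%N; last first.
    rewrite /u lognM ?expn_gt0// !lognX (logn_prime 2 (isT : prime 2)).
    by rewrite (logn_prime 2 (isT : prime 3)) muln1 muln0 addn0 pickleK.
  apply: leq_trans (ltnW (ltn_expl N (isT : (1 < 3)%N))) _.
  by rewrite leq_pmull// expn_gt0.
have /choice[A AP] : forall k, exists Ak : R, 0 <= Ak /\
    forall i, `|u k (e i)| <= Ak * 2^-1 ^+ (i * i).
  move=> k; rewrite /u; case: unpickle => [s|].
    exact: int_comb_decay.
  by exists 0; split=> // i; rewrite mul0r normr0.
have [w wP] := choice power_functional.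
pose v k := u k + 2^-1 ^+ k *: w k.
pose B k := `|v k| * m.
have vB k x : `|v k x| <= B k * b x.
  by apply: le_trans (dual_apply_le _ _) _; rewrite /B -mulrA ler_wpM2l.
have B0 k : 0 <= B k by rewrite mulr_ge0.
have A0 k : 0 <= A k by case: (AP k).
(* The denominator makes [sg k] times each of [1], [A k] and [B k] at most [d * 2^-1 ^+ k]. *)
pose sg k := d * 2^-1 ^+ k / (1 + A k + B k).
have den k : 0 < 1 + A k + B k by rewrite -addrA ltr_pwDl// addr_ge0.
have sg0 k : 0 < sg k by rewrite divr_gt0// mulr_gt0 ?exp_half_gt0.
have sgle k t : 0 <= t -> t <= 1 + A k + B k -> sg k * t <= d * 2^-1 ^+ k.
  move=> t0 td; rewrite /sg mulrAC ler_pdivrMr// ler_wpM2l//.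
  by rewrite mulr_ge0 ?exp_half_ge0// ltW.
have dle k : d * 2^-1 ^+ k <= 2^-1 ^+ k by rewrite ler_piMl ?exp_half_ge0.
have sg1 k : sg k <= 2^-1 ^+ k.
  apply: le_trans (dle k); rewrite -[leLHS]mulr1; apply: sgle => //.
  by rewrite -addrA lerDl addr_ge0.
have sgA k i : `|sg k * u k (e i)| <= 2^-1 ^+ k * 2^-1 ^+ (i * i).
  rewrite normrM gtr0_norm//; have [_ uA] := AP k.
  apply: le_trans (ler_wpM2l (ltW (sg0 k)) (uA i)) _.
  rewrite mulrA ler_wpM2r ?exp_half_ge0//; apply: le_trans (dle k); apply: sgle => //.
  by rewrite addrAC lerDr addr_ge0.
pose a k := sg k *: v k.
have aE k i : a k (e i) = sg k * u k (e i) + sg k * 2^-1 ^+ k * 2^-1 ^+ (k.+1 * i).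
  rewrite /a /v dual_scaleE dual_addE dual_scaleE.
  by have [_ ->] := wP k; ring.
exists a; split.
- move=> k x; rewrite /a dual_scaleE normrM gtr0_norm//.
  apply: le_trans (ler_wpM2l (ltW (sg0 k)) (vB k x)) _.
  by rewrite mulrA ler_wpM2r//; apply: sgle => //; rewrite lerDr addr_ge0.
- move=> k i; rewrite aE; apply: le_trans (ler_normD _ _) _.
  have -> : 2 * 2^-1 ^+ k * 2^-1 ^+ i =
    2^-1 ^+ k * 2^-1 ^+ i + 2^-1 ^+ k * 2^-1 ^+ i :> R by ring.
  apply: lerD.
    apply: le_trans (sgA k i) _; rewrite ler_wpM2l ?exp_half_ge0// exp_half_le//.
    by case: i => // i; rewrite leq_pmull.
  rewrite normrM [`|2^-1 ^+ (_ * _)|]ger0_norm ?exp_half_ge0//.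
  apply: ler_pM; rewrite ?exp_half_ge0//; last by rewrite exp_half_le// leq_pmull.
  rewrite normrM !ger0_norm ?exp_half_ge0 ?(ltW (sg0 k))//.
  by apply: le_trans (sg1 k); rewrite ler_piMr ?exp_half_le1// ltW.
- move=> c C cC [N hN].
  have C0 : 0 <= C by apply: le_trans (cC 0%N).
  (* Once the coefficients before [n] vanish, the leading part at [e i] is [c' * 2^-((n+1)i)], and
     the remainder [r] is smaller by a factor of order [2^-i]. The condition [n.+2 <= i] ensures
     [n.+2 * i <= i * i], which controls the terms from [u]. *)
  elim/ltn_ind => n ih.
  pose c' := c n * (sg n * 2^-1 ^+ n).
  suff c'0 : c' = 0.
    move: c'0 => /eqP; rewrite mulf_eq0 mulf_eq0 (gt_eqF (sg0 n)).
    by rewrite (gt_eqF (@exp_half_gt0 R n)) !orbF => /eqP.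
  have small i : (N <= i)%N -> (n.+2 <= i)%N -> `|c'| <= 4 * C * 2^-1 ^+ i.
    move=> Ni ni.
    pose r k := c k * a k (e i) + - 1 * ((k == n)%:R * (c' * 2^-1 ^+ (n.+1 * i))).
    have ca : geometric_bound (fun k => c k * a k (e i)) (C * (d * b (e i))).
      move=> k; rewrite normrM -!mulrA ler_pM//; rewrite /a dual_scaleE normrM gtr0_norm//.
      apply: le_trans (ler_wpM2l (ltW (sg0 k)) (vB k (e i))) _.
      have -> : d * (b (e i) * 2^-1 ^+ k) = d * 2^-1 ^+ k * b (e i) by ring.
      by rewrite mulrA ler_wpM2r//; apply: sgle => //; rewrite lerDr addr_ge0.
    have rb : geometric_bound r (2 * C * 2^-1 ^+ (n.+2 * i)).
      move=> k.
      have uk : `|c k * (sg k * u k (e i))| <= C * 2^-1 ^+ (n.+2 * i) * 2^-1 ^+ k.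
        rewrite normrM -mulrA ler_pM// [leRHS]mulrC.
        apply: le_trans (sgA k i) _; rewrite ler_wpM2l ?exp_half_ge0// exp_half_le//.
        by rewrite leq_pmul2r// (leq_trans _ ni).
      have rE : r k = c k * (sg k * u k (e i)) +
          (k != n)%:R * (c k * (sg k * 2^-1 ^+ k * 2^-1 ^+ (k.+1 * i))).
        rewrite /r aE /c'; case: eqP => [->|_] /=; ring.
      rewrite rE; apply: le_trans (ler_normD _ _) _.
      have -> : 2 * C * 2^-1 ^+ (n.+2 * i) * 2^-1 ^+ k =
        C * 2^-1 ^+ (n.+2 * i) * 2^-1 ^+ k +
        C * 2^-1 ^+ (n.+2 * i) * 2^-1 ^+ k :> R by ring.
      apply: lerD => //.
      have rhs0 : 0 <= C * 2^-1 ^+ (n.+2 * i) * 2^-1 ^+ k :> R.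
        by rewrite !mulr_ge0 ?exp_half_ge0.
      case: (ltngtP k n) => [kn|nk|_]; rewrite ?mul0r ?normr0//=.
        by rewrite ih// mul0r mulr0 normr0.
      rewrite mul1r normrM -[leRHS]mulrA; apply: ler_pM => //.
      have sh0 : 0 <= sg k * 2^-1 ^+ k.
        by apply: mulr_ge0; [exact: ltW|exact: exp_half_ge0].
      rewrite mulrC ger0_norm; last by exact: mulr_ge0 (exp_half_ge0 _) sh0.
      apply: ler_pM; [exact: exp_half_ge0|exact: sh0| |].
        by rewrite exp_half_le// leq_mul2r ltnS nk orbT.
      by apply: le_trans (sg1 k); rewrite ler_piMr ?exp_half_le1// ltW.
    have := ssum_bound rb.
    have sb := geometric_bound_single n (c' * 2^-1 ^+ (n.+1 * i)).
    rewrite (ssumD ca (geometric_boundZ (-1) sb)) (ssumZ (-1) sb).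
    rewrite ssum_single hN// add0r mulN1r normrN normrM.
    rewrite [`|_ ^+ _|]ger0_norm ?exp_half_ge0// [(n.+2 * i)%N]mulSn exprD.
    have -> : 2 * (2 * C * (2^-1 ^+ i * 2^-1 ^+ (n.+1 * i))) =
      4 * C * 2^-1 ^+ i * 2^-1 ^+ (n.+1 * i) :> R by ring.
    by rewrite ler_pM2r// exp_half_gt0.
  apply/eqP; rewrite -normr_eq0 eq_le normr_ge0 andbT.
  apply/ler_addgt0Pr => eps eps0; rewrite add0r.
  have C1 : 0 < 4 * C + 1 by rewrite ltr_wpDl// mulr_ge0.
  have [N' hN'] := exp_half_small (divr_gt0 eps0 C1).
  pose i := maxn N (maxn n.+2 N').
  have /small : (N <= i)%N by rewrite leq_max leqnn.
  have ni : (n.+2 <= i)%N by rewrite !leq_max leqnn orbT.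
  move=> /(_ ni) h; apply: le_trans h _.
  have N'i : (N' <= i)%N by rewrite !leq_max leqnn !orbT.
  have := hN' i N'i; rewrite ler_pdivlMr// => h; apply: le_trans h.
  by rewrite [leRHS]mulrC ler_wpM2r ?exp_half_ge0// lerDl.
- move=> s eps eps0.
  have [N hN] := exp_half_small (divr_gt0 eps0 (ltr0n R 2)).
  have [k Nk uk] := u_inf s N.
  exists k, (sg k)^-1 => x; rewrite /a dual_scaleE mulKf ?gt_eqF//.
  rewrite /v dual_addE dual_scaleE uk.
  have -> : int_comb s x - (int_comb s x + 2^-1 ^+ k * w k x) =
    - (2^-1 ^+ k * w k x) by ring.
  rewrite normrN normrM ger0_norm ?exp_half_ge0//.
  have [wb _] := wP k; apply: le_trans (ler_pM _ _ (hN k Nk) (wb x)) _;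
    rewrite ?exp_half_ge0//.
  by rewrite mulrA -(mulrA eps) mulVf ?mulr1.
Qed.

End IndependentFamily.

(** * Norms from convex functions homogeneous of degree four *)

Section FourthPower.
Context {R : realType}.
Implicit Types a b l r : R.

Lemma sqr_convex a b l : 0 <= l <= 1 ->
  (l * a + (1 - l) * b) ^+ 2 <= l * a ^+ 2 + (1 - l) * b ^+ 2.
Proof.
move=> /andP[l0 l1]; rewrite -subr_ge0.
have -> : l * a ^+ 2 + (1 - l) * b ^+ 2 - (l * a + (1 - l) * b) ^+ 2 =
  l * (1 - l) * (a - b) ^+ 2 by ring.
by apply: mulr_ge0 (sqr_ge0 _); rewrite mulr_ge0 ?subr_ge0.
Qed.

Lemma pow4_ge0 a : 0 <= a ^+ 4.
Proof. by rewrite (exprM a 2 2) sqr_ge0. Qed.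

Lemma pow4_convex a b l : 0 <= l <= 1 ->
  (l * a + (1 - l) * b) ^+ 4 <= l * a ^+ 4 + (1 - l) * b ^+ 4.
Proof.
move=> l01; have /andP[l0 l1] := l01.
rewrite (exprM _ 2 2) (exprM a 2 2) (exprM b 2 2).
apply: le_trans (sqr_convex (a ^+ 2) (b ^+ 2) l01).
rewrite ler_pXn2r ?nnegrE ?sqr_ge0//; first exact: sqr_convex.
by apply: addr_ge0; apply: mulr_ge0 (sqr_ge0 _); rewrite ?subr_ge0.
Qed.

Lemma pow4_midpoint a b :
  ((a + b) / 2) ^+ 4 + ((a - b) / 2) ^+ 4 <= (a ^+ 4 + b ^+ 4) / 2.
Proof.
rewrite -subr_ge0.
have -> : (a ^+ 4 + b ^+ 4) / 2 - (((a + b) / 2) ^+ 4 + ((a - b) / 2) ^+ 4) =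
  6 * (((a + b) / 2) * ((a - b) / 2)) ^+ 2 by field.
by apply: mulr_ge0 (sqr_ge0 _).
Qed.

Lemma pow4_le a b : 0 <= b -> (a ^+ 4 <= b ^+ 4) = (`|a| <= b).
Proof.
move=> b0; have -> : a ^+ 4 = `|a| ^+ 4.
  by rewrite !(exprM _ 2 2) real_normK// num_real.
by rewrite ler_pXn2r// nnegrE.
Qed.

(** The tangent of the fourth power at [1]; it turns estimates on [q ^+ 4] near the unit sphere into
    linear ones on [q]. *)
Lemma pow4_tangent a : 4 * a - 3 <= a ^+ 4.
Proof.
rewrite -subr_ge0.
have -> : a ^+ 4 - (4 * a - 3) = (a ^+ 2 - 1) ^+ 2 + 2 * (a - 1) ^+ 2 by ring.
by apply: addr_ge0 (sqr_ge0 _) (mulr_ge0 _ (sqr_ge0 _)).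
Qed.

Context {X : normedModType R}.

(** The triangle inequality is convexity of [Psi] at the normalized vectors, with weights
    proportional to [q x] and [q y]. *)
Lemma fourth_root_norm (Psi : X -> R) (m M : R) :
  (forall x y l, 0 <= l <= 1 ->
     Psi (l *: x + (1 - l) *: y) <= l * Psi x + (1 - l) * Psi y) ->
  (forall (a : R) x, Psi (a *: x) = a ^+ 4 * Psi x) ->
  0 < m -> 0 <= M ->
  (forall x, (m * `|x|) ^+ 4 <= Psi x <= (M * `|x|) ^+ 4) ->
  exists q : equiv_norm X, (forall x, 0 <= q x) /\ forall x, q x ^+ 4 = Psi x.
Proof.
move=> Psi_convex PsiZ m0 M0 Psi_bd.
have Psi0 x : 0 <= Psi x.
  by have /andP[h _] := Psi_bd x; apply: le_trans h; exact: pow4_ge0.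
pose q x : R := Num.sqrt (Num.sqrt (Psi x)).
have q4 x : q x ^+ 4 = Psi x by rewrite (exprM _ 2 2) !sqr_sqrtr// sqrtr_ge0.
have q0 x : 0 <= q x by exact: sqrtr_ge0.
have qZ a x : q (a *: x) = `|a| * q x.
  apply/eqP; rewrite eq_le; apply/andP; split.
    rewrite -[leLHS]ger0_norm// -pow4_le ?mulr_ge0// q4 PsiZ exprMn q4.
    by rewrite !(exprM _ 2 2) real_normK// num_real.
  rewrite -[leLHS]ger0_norm ?mulr_ge0// -pow4_le// q4 PsiZ exprMn q4.
  by rewrite !(exprM _ 2 2) real_normK// num_real.
have q_lb x : m * `|x| <= q x.
  rewrite -[leLHS]ger0_norm ?mulr_ge0// ?(ltW m0)// -pow4_le// q4.
  by case/andP: (Psi_bd x).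
have q_ub x : q x <= M * `|x|.
  rewrite -[leLHS]ger0_norm// -pow4_le ?mulr_ge0// q4.
  by case/andP: (Psi_bd x).
have q_eq0 x : q x = 0 -> x = 0.
  move=> qx; have := q_lb x; rewrite qx pmulr_rle0// normr_le0.
  by move/eqP.
have qD x y : q (x + y) <= q x + q y.
  have [qx0|qx0] := eqVneq (q x) 0.
    by rewrite qx0 (q_eq0 _ qx0) !add0r.
  have [qy0|qy0] := eqVneq (q y) 0.
    by rewrite qy0 (q_eq0 _ qy0) !addr0.
  have qxp : 0 < q x by rewrite lt_neqAle eq_sym qx0 q0.
  have qyp : 0 < q y by rewrite lt_neqAle eq_sym qy0 q0.
  set s := q x + q y; have s0 : 0 < s by rewrite addr_gt0.
  rewrite -[leLHS]ger0_norm// -pow4_le ?(ltW s0)// q4.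
  pose l := q x / s; have l1 : 1 - l = q y / s by rewrite /l /s; field; rewrite gt_eqF.
  have l01 : 0 <= l <= 1.
    by rewrite divr_ge0 ?(ltW s0)//= -subr_ge0 l1 divr_ge0// ltW.
  have -> : x + y = s *: (l *: ((q x)^-1 *: x) + (1 - l) *: ((q y)^-1 *: y)).
    rewrite scalerDr !scalerA l1 /l; congr (_ + _); rewrite -[LHS]scale1r;
    congr (_ *: _); field; by rewrite !gt_eqF.
  rewrite PsiZ ler_piMr ?pow4_ge0//.
  apply: le_trans (Psi_convex _ _ _ l01) _; rewrite !PsiZ -!q4 !exprVn.
  by rewrite !mulVf ?expf_neq0// !mulr1 subrKC.
have q_equiv : exists m M : R, 0 < m /\ forall x, m * `|x| <= q x <= M * `|x|.
  by exists m, M; split=> // x; rewrite q_lb q_ub.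
by exists (EquivNorm qD qZ q_eq0 q_equiv).
Qed.

End FourthPower.

(** * Infimal convolution *)

Section InfConvolution.
Context {R : realType} {X : normedModType R}.
Context (b : X -> R) (d : R) (y : nat -> X) (e : nat -> X) (T : {linear X -> c0 R}).
Hypotheses (bD : forall x x', b (x + x') <= b x + b x')
  (bZ : forall (a : R) x, b (a *: x) = `|a| * b x) (b0 : forall x, 0 <= b x)
  (d0 : 0 < d) (d1 : d < 3^-1)
  (y_le : forall i, b (y i) <= d / 2 * 2^-1 ^+ i * 2^-1 ^+ i)
  (Tb : forall x, `|T x| <= b x)
  (b_bump : forall x i (t : R), b (x + t *: e i) <= Num.max (b x) (`|t| + `|T x i|)).

Implicit Types w : {poly R}.

(* Finitely supported sequences are encoded as polynomials. *)
Definition comb (w : {poly R}) : X := \sum_(i < size w) w`_i *: y i.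

Definition cost (w : {poly R}) : R := \sum_(i < size w) w`_i ^+ 4.

Definition infconv (x : X) : R :=
  inf [set b (x - comb w) ^+ 4 + cost w | w in [set: {poly R}]].

Lemma comb_widen n w : (size w <= n)%N -> comb w = \sum_(i < n) w`_i *: y i.
Proof.
move=> wn; rewrite /comb (big_ord_widen n (fun i => w`_i *: y i) wn).
rewrite [RHS](bigID (fun i : 'I_n => (i < size w)%N))/= [X in _ + X]big1 ?addr0//.
by move=> i; rewrite -leqNgt => wi; rewrite nth_default// scale0r.
Qed.

Lemma cost_widen n w : (size w <= n)%N -> cost w = \sum_(i < n) w`_i ^+ 4.
Proof.
move=> wn; rewrite /cost (big_ord_widen n (fun i => w`_i ^+ 4) wn).
rewrite [RHS](bigID (fun i : 'I_n => (i < size w)%N))/= [X in _ + X]big1 ?addr0//.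
by move=> i; rewrite -leqNgt => wi; rewrite nth_default// expr0n.
Qed.

Lemma size_pair (v w : {poly R}) : exists n, (size v <= n)%N /\ (size w <= n)%N.
Proof. by exists (maxn (size v) (size w)); rewrite leq_maxl leq_maxr. Qed.

Lemma comb_linear (a c : R) v w : comb (a *: v + c *: w) = a *: comb v + c *: comb w.
Proof.
have [n [vn wn]] := size_pair v w.
rewrite (@comb_widen n); last first.
  apply: leq_trans (size_polyD _ _) _; rewrite geq_max.
  by rewrite (leq_trans (size_scale_leq _ _))// (leq_trans (size_scale_leq _ _)).
rewrite (comb_widen vn) (comb_widen wn) !scaler_sumr -big_split/=.
by apply: eq_bigr => i _; rewrite coefD !coefZ scalerDl !scalerA.
Qed.

Lemma comb0 : comb 0 = 0.
Proof. by rewrite /comb size_poly0 big_ord0. Qed.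

Lemma cost0 : cost 0 = 0.
Proof. by rewrite /cost size_poly0 big_ord0. Qed.

Lemma cost_ge0 w : 0 <= cost w.
Proof. by apply: sumr_ge0 => i _; exact: pow4_ge0. Qed.

Lemma costZ (a : R) w : cost (a *: w) = a ^+ 4 * cost w.
Proof.
rewrite (@cost_widen (size w)) ?size_scale_leq// /cost mulr_sumr.
by apply: eq_bigr => i _; rewrite coefZ exprMn.
Qed.

Lemma cost_convex l v w : 0 <= l <= 1 ->
  cost (l *: v + (1 - l) *: w) <= l * cost v + (1 - l) * cost w.
Proof.
move=> l01; have [n [vn wn]] := size_pair v w.
rewrite (@cost_widen n); last first.
  apply: leq_trans (size_polyD _ _) _; rewrite geq_max.
  by rewrite (leq_trans (size_scale_leq _ _))// (leq_trans (size_scale_leq _ _)).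
rewrite (cost_widen vn) (cost_widen wn) !mulr_sumr -big_split/=.
by apply: ler_sum => i _; rewrite coefD !coefZ pow4_convex.
Qed.

Lemma coef_pow4_le_cost w i : w`_i ^+ 4 <= cost w.
Proof.
have [wi|iw] := leqP (size w) i.
  by rewrite nth_default// expr0n cost_ge0.
rewrite /cost (bigD1 (Ordinal iw))//= lerDl sumr_ge0// => j _; exact: pow4_ge0.
Qed.

(** The odd powers of [s] cancel, so the cost is smooth to second order along each coordinate. *)
Lemma cost_sym (s : R) j w :
  cost (w + s *: 'X^j) + cost (w + - s *: 'X^j) =
  2 * cost w + 12 * s ^+ 2 * w`_j ^+ 2 + 2 * s ^+ 4.
Proof.
pose n := maxn (size w) j.+1.
have wn : (size w <= n)%N by rewrite leq_maxl.
have jn : (j < n)%N by rewrite leq_maxr.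
have sz (t : R) : (size (w + t *: 'X^j)%R <= n)%N.
  apply: leq_trans (size_polyD _ _) _; rewrite geq_max wn.
  by rewrite (leq_trans (size_scale_leq _ _))// size_polyXn.
rewrite !(cost_widen (sz _)) (cost_widen wn) -big_split/=.
rewrite (bigD1 (Ordinal jn))//= [in RHS](bigD1 (Ordinal jn))//=.
have -> : \sum_(i < n | i != Ordinal jn)
    ((w + s *: 'X^j)`_i ^+ 4 + (w + - s *: 'X^j)`_i ^+ 4) =
    2 * \sum_(i < n | i != Ordinal jn) w`_i ^+ 4.
  rewrite mulr_sumr; apply: eq_bigr => i ij.
  have nij : (i == j :> nat) = false.
    by apply/negP => /eqP e'; case/eqP: ij; apply/val_inj.
  by rewrite !coefD !coefZ !coefXn nij !mulr0 !addr0; ring.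
rewrite !coefD !coefZ !coefXn eqxx /=; ring.
Qed.

Lemma combD_Xn (s : R) j w : comb (w + s *: 'X^j) = comb w + s *: y j.
Proof.
rewrite -[w in LHS]scale1r comb_linear scale1r; congr (_ + _ *: _).
rewrite (@comb_widen j.+1) ?size_polyXn// big_ord_recr/= coefXn eqxx scale1r.
rewrite big1 ?add0r// => i _.
by rewrite coefXn (ltn_eqF (ltn_ord i)) scale0r.
Qed.

Lemma b_zero : b 0 = 0.
Proof. by have := bZ 0 0; rewrite scale0r normr0 mul0r. Qed.

Lemma b_sum n (F : nat -> X) : b (\sum_(i < n) F i) <= \sum_(i < n) b (F i).
Proof.
elim: n => [|n ih]; first by rewrite !big_ord0 b_zero.
by rewrite !big_ord_recr/=; apply: le_trans (bD _ _) _; rewrite lerD2r.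
Qed.

Lemma coef_le_of_cost w (r : R) i : 0 <= r -> cost w <= r ^+ 4 -> `|w`_i| <= r.
Proof.
move=> r0 wr; rewrite -pow4_le//.
exact: le_trans (coef_pow4_le_cost _ _) wr.
Qed.

Lemma b_comb w (r : R) : 0 <= r -> cost w <= r ^+ 4 -> b (comb w) <= d * r.
Proof.
move=> r0 wr; apply: le_trans (b_sum _ (fun i => w`_i *: y i)) _.
have gb : geometric_bound (fun i => b (w`_i *: y i)) (d / 2 * r).
  move=> i; rewrite ger0_norm// bZ.
  apply: le_trans (ler_pM _ _ (coef_le_of_cost i r0 wr) (y_le i)) _ => //.
  have -> : r * (d / 2 * 2^-1 ^+ i * 2^-1 ^+ i) =
    d / 2 * r * 2^-1 ^+ i * 2^-1 ^+ i by ring.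
  rewrite ler_piMr ?exp_half_le1//.
  by apply: mulr_ge0 (exp_half_ge0 _); rewrite mulr_ge0// divr_ge0// ltW.
have := geometric_bound_sum (size w) gb; rewrite big_mkord.
have -> : 2 * (d / 2 * r) = d * r by field.
apply: le_trans; apply: ler_sum => i _; exact: ler_norm.
Qed.

Lemma has_inf_infconv x :
  has_inf [set b (x - comb w) ^+ 4 + cost w | w in [set: {poly R}]].
Proof.
split; first by exists (b (x - comb 0) ^+ 4 + cost 0), 0.
by exists 0 => _ [w _ <-]; rewrite addr_ge0 ?cost_ge0 ?pow4_ge0.
Qed.

Lemma infconv_le x w : infconv x <= b (x - comb w) ^+ 4 + cost w.
Proof. by apply: ge_inf; [exact: (has_inf_infconv x).2|exists w]. Qed.

Lemma infconv_ge x (c : R) :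
  (forall w, c <= b (x - comb w) ^+ 4 + cost w) -> c <= infconv x.
Proof.
move=> h; apply: lb_le_inf; first exact: (has_inf_infconv x).1.
by move=> _ [w _ <-].
Qed.

Lemma infconv_approx x (eta : R) : 0 < eta ->
  exists w, b (x - comb w) ^+ 4 + cost w < infconv x + eta.
Proof.
move=> eta0; have [_ [w _ <-] h] := inf_adherent eta0 (has_inf_infconv x).
by exists w.
Qed.

Lemma infconv_ub x : infconv x <= b x ^+ 4.
Proof. by have := infconv_le x 0; rewrite comb0 cost0 subr0 addr0. Qed.

Lemma b_subl x x' : b x - b x' <= b (x - x').
Proof. by have := bD (x - x') x'; rewrite subrK; lra. Qed.

(** Either [w] is cheap and [comb w] moves [x] by at most [d * b x], or the cost of [w] alone
    exceeds [b x ^+ 4]. *)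
Lemma infconv_lb x : ((1 - d) * b x) ^+ 4 <= infconv x.
Proof.
have d10 : 0 <= 1 - d by move: (d1); lra.
apply: infconv_ge => w; have [wr|wr] := leP (cost w) (b x ^+ 4).
  apply: le_trans (_ : b (x - comb w) ^+ 4 <= _); last by rewrite lerDl cost_ge0.
  rewrite ler_pXn2r ?nnegrE ?mulr_ge0//.
  by have := b_comb (b0 x) wr; have := b_subl x (comb w); lra.
apply: le_trans (_ : b x ^+ 4 <= _).
  rewrite ler_pXn2r ?nnegrE ?mulr_ge0// ler_piMl//; move: (d0); lra.
by apply: le_trans (ltW wr) _; rewrite lerDr pow4_ge0.
Qed.

Lemma infconv_convex x x' l : 0 <= l <= 1 ->
  infconv (l *: x + (1 - l) *: x') <= l * infconv x + (1 - l) * infconv x'.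
Proof.
move=> l01; have /andP[l0 l1] := l01.
have l10 : 0 <= 1 - l by rewrite subr_ge0.
apply/ler_addgt0Pr => eta eta0.
have [w hw] := infconv_approx x eta0; have [w' hw'] := infconv_approx x' eta0.
apply: le_trans (infconv_le _ (l *: w + (1 - l) *: w')) _.
rewrite comb_linear.
have -> : l *: x + (1 - l) *: x' - (l *: comb w + (1 - l) *: comb w') =
    l *: (x - comb w) + (1 - l) *: (x' - comb w').
  by rewrite !scalerBr addrACA opprD.
have h1 : b (l *: (x - comb w) + (1 - l) *: (x' - comb w')) ^+ 4 <=
    l * b (x - comb w) ^+ 4 + (1 - l) * b (x' - comb w') ^+ 4.
  apply: le_trans (pow4_convex _ _ l01).
  rewrite ler_pXn2r ?nnegrE ?addr_ge0 ?mulr_ge0//.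
  by apply: le_trans (bD _ _) _; rewrite !bZ !ger0_norm.
have h2 := cost_convex w w' l01.
have := ler_wpM2l l0 (ltW hw); have := ler_wpM2l l10 (ltW hw').
rewrite !mulrDr; lra.
Qed.

Lemma infconvZ (a : R) x : infconv (a *: x) = a ^+ 4 * infconv x.
Proof.
have le c z : infconv (c *: z) <= c ^+ 4 * infconv z.
  have [->|c0] := eqVneq c 0.
    rewrite scale0r expr0n mul0r; apply: le_trans (infconv_ub 0) _.
    by rewrite b_zero expr0n.
  have c40 : 0 < c ^+ 4 by rewrite lt_neqAle eq_sym expf_neq0//= pow4_ge0.
  rewrite -ler_pdivrMl//; apply: infconv_ge => w; rewrite ler_pdivrMl//.
  apply: le_trans (infconv_le _ (c *: w)) _.
  have -> : comb (c *: w) = c *: comb w.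
    by have := comb_linear c 0 w 0; rewrite !scale0r !addr0.
  rewrite -scalerBr bZ costZ mulrDr exprMn.
  by rewrite [`|c| ^+ 4](exprM _ 2 2) real_normK ?num_real// -exprM.
apply/eqP; rewrite eq_le le/=.
have [->|a0] := eqVneq a 0.
  rewrite expr0n mul0r scale0r; apply: infconv_ge => w.
  by rewrite addr_ge0 ?pow4_ge0 ?cost_ge0.
have a40 : 0 < a ^+ 4 by rewrite lt_neqAle eq_sym expf_neq0//= pow4_ge0.
rewrite -ler_pdivlMl// -exprVn; have := le a^-1 (a *: x).
by rewrite scalerA mulVf// scale1r.
Qed.

(** Absorbing the step [s *: y j] into [w] leaves [x - comb w] unchanged, so only the cost changes,
    to second order in [s]. *)
Lemma infconv_smooth x (s : R) j : `|s| <= 1 ->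
  infconv (x + s *: y j) + infconv (x - s *: y j) <=
  2 * infconv x + 14 * s ^+ 2 * (1 + infconv x).
Proof.
move=> s1; have s21 : s ^+ 2 <= 1.
  by rewrite -real_normK ?num_real// expr_le1.
have s20 : 0 <= s ^+ 2 by exact: sqr_ge0.
have key w : infconv (x + s *: y j) + infconv (x - s *: y j) <=
    (2 + 14 * s ^+ 2) * (b (x - comb w) ^+ 4 + cost w) + 14 * s ^+ 2.
  have := infconv_le (x + s *: y j) (w + s *: 'X^j).
  have := infconv_le (x - s *: y j) (w + - s *: 'X^j).
  rewrite !combD_Xn scaleNr.
  have -> : x - s *: y j - (comb w - s *: y j) = x - comb w.
    by rewrite opprB addrA subrK.
  have -> : x + s *: y j - (comb w + s *: y j) = x - comb w.
    by rewrite opprD addrACA subrr addr0.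
  have := cost_sym s j w; rewrite scaleNr.
  have cw : w`_j ^+ 2 <= 1 + cost w.
    have := coef_pow4_le_cost w j; rewrite (exprM _ 2 2).
    have : 0 <= (w`_j ^+ 2 - 1) ^+ 2 by exact: sqr_ge0.
    have := sqr_ge0 w`_j; nra.
  have s4 : s ^+ 4 <= s ^+ 2 by rewrite (exprM s 2 2) expr2 ler_piMr.
  have := ler_wpM2l s20 cw; have := cost_ge0 w.
  have := pow4_ge0 (b (x - comb w)).
  move: (b _ ^+ 4) => B B0 W0 h1 h2 h3 h4.
  have := mulr_ge0 s20 B0; have := mulr_ge0 s20 W0.
  lra.
have p0 : 0 < 2 + 14 * s ^+ 2 by lra.
(* The factor in [key] is the same for all [w]; after division by it the infimum over [w] can be
   taken. *)
suff : (infconv (x + s *: y j) + infconv (x - s *: y j) - 14 * s ^+ 2) /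
    (2 + 14 * s ^+ 2) <= infconv x.
  rewrite ler_pdivrMr//; lra.
apply: infconv_ge => w; rewrite ler_pdivrMr//; have := key w; lra.
Qed.

(** Of the two factors [2^-j] in [y_le], one makes the terms of the tail small and the other makes
    them summable; the finitely many remaining [T (y j)] are null sequences. *)
Lemma T_comb_small (r eta : R) : 0 <= r -> 0 < eta -> exists N, forall i w,
  (N <= i)%N -> cost w <= r ^+ 4 -> `|T (comb w) i| <= eta.
Proof.
move=> r0 eta0.
have r1 : 0 < r + 1 by rewrite ltr_wpDl.
have h0 : 0 < eta / (r + 1) / 2 by rewrite !divr_gt0.
have [J hJ] := exp_half_small h0.
have [N hN] : exists N, forall i, (N <= i)%N -> forall j, (j < J)%N ->
    `|T (y j) i| <= eta / (r + 1) / 2 * 2^-1 ^+ j.+1.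
  elim: J {hJ} => [|J [N hN]]; first by exists 0%N.
  have h1 : 0 < eta / (r + 1) / 2 * 2^-1 ^+ J.+1 by rewrite mulr_gt0// exp_half_gt0.
  have [N' hN'] := c0_near (T (y J)) h1.
  exists (maxn N N') => i; rewrite geq_max => /andP[Ni N'i] j.
  rewrite ltnS leq_eqVlt => /orP[/eqP ->|jJ]; [exact: hN'|exact: hN].
exists N => i w Ni wr.
have gb : geometric_bound (fun j => `|T (y j) i|) (eta / (r + 1) / 2).
  move=> j; rewrite normr_id; have [Jj|jJ] := leqP J j; last first.
    apply: le_trans (hN i Ni j jJ) _; rewrite ler_wpM2l ?(ltW h0)//.
    exact: exp_half_le.
  apply: le_trans (c0_normE _ _) _; apply: le_trans (Tb _) _.
  apply: le_trans (y_le j) _; rewrite ler_wpM2r ?exp_half_ge0//.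
  apply: le_trans (hJ j Jj); rewrite ler_piMl ?exp_half_ge0//; move: (d1); lra.
have TcE : T (comb w) i = \sum_(j < size w) w`_j * T (y j) i.
  rewrite /comb linear_sum.
  elim/big_rec2: _ => [//|j _ u _ <-].
  by rewrite -[LHS]/(T (w`_j *: y j) i + u i) linearZ.
rewrite TcE; apply: le_trans (ler_norm_sum _ _ _) _.
apply: le_trans (_ : \sum_(j < size w) r * `|T (y j) i| <= _).
  by apply: ler_sum => j _; rewrite normrM ler_wpM2r// coef_le_of_cost.
rewrite -mulr_sumr.
have := geometric_bound_sum (size w) gb; rewrite big_mkord.
have -> : \sum_(j < size w) `| `|T (y j) i| | = \sum_(j < size w) `|T (y j) i|.
  by apply: eq_bigr => j _; rewrite normr_id.
move=> h; apply: le_trans (ler_wpM2l r0 h) _.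
have -> : r * (2 * (eta / (r + 1) / 2)) = eta * (r / (r + 1)).
  by field; rewrite gt_eqF.
by rewrite ler_piMr ?(ltW eta0)// ler_pdivrMr// mul1r lerDl.
Qed.

(* Nearly optimal [w] have bounded cost, so that [x - comb w] stays large
   while its [i]-th coordinate is small uniformly in [w]. *)
Lemma infconv_bump x : 0 < b x -> exists N, forall i (t : R), (N <= i)%N ->
  `|t| <= (1 - 3 * d) * b x -> infconv (x + t *: e i) <= infconv x.
Proof.
move=> bx0; have b4 : 0 < b x ^+ 4 by rewrite exprn_gt0.
have dbx : 0 < d / 2 * b x by rewrite !mulr_gt0.
have r0 : 0 <= 2 * b x by rewrite mulr_ge0.
have [N hN] := T_comb_small r0 dbx; have [N' hN'] := c0_near (T x) dbx.
exists (maxn N N') => i t; rewrite geq_max => /andP[Ni N'i] tb.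
apply/ler_addgt0Pr => eta eta0.
(* The cap [b x ^+ 4] keeps the cost of [w] below [2 * b x ^+ 4], hence below the fourth power of
   [2 * b x]. *)
have m0 : 0 < Num.min eta (b x ^+ 4) by rewrite lt_min eta0.
have [w hw] := infconv_approx x m0.
have wr : cost w <= (2 * b x) ^+ 4.
  have := infconv_ub x; have := pow4_ge0 (b (x - comb w)).
  have : Num.min eta (b x ^+ 4) <= b x ^+ 4 by rewrite ge_min lexx orbT.
  by rewrite exprMn; lra.
apply: le_trans (infconv_le _ w) _.
apply: le_trans (_ : b (x - comb w) ^+ 4 + cost w <= _); last first.
  apply: le_trans (ltW hw) _; rewrite lerD2l ge_min lexx//.
rewrite lerD2r ler_pXn2r ?nnegrE//.
rewrite addrAC; apply: le_trans (b_bump _ _ _) _; rewrite ge_max lexx/=.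
(* The changed coordinate is at most [(1 - 3 * d) * b x + d * b x], while [b (x - comb w)] is at
   least [(1 - 2 * d) * b x]. *)
have Tx : `|T (x - comb w) i| <= d / 2 * b x + d / 2 * b x.
  rewrite linearB; apply: le_trans (ler_normB _ _) _.
  by apply: lerD; [exact: hN'|exact: hN].
have := b_comb r0 wr; have := b_subl x (comb w); move: (d0) (d1).
lra.
Qed.

End InfConvolution.

(** * Sums of fourth powers *)

Section FourthPowerSum.
Context {R : realType}.
Implicit Types (s u : nat -> R).

Lemma geometric_boundM s u (C D : R) : geometric_bound s C -> geometric_bound u D ->
  geometric_bound (fun k => s k * u k) (C * D).
Proof.
move=> sC uD k; rewrite normrM; apply: le_trans (ler_pM _ _ (sC k) (uD k)) _ => //.
have C0 : 0 <= C by have := sC 0%N; rewrite expr0 mulr1; apply: le_trans.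
have D0 : 0 <= D by have := uD 0%N; rewrite expr0 mulr1; apply: le_trans.
rewrite -[leRHS]mulrA mulrACA -mulrA ler_wpM2l// ler_wpM2l//.
by rewrite ler_piMl ?exp_half_ge0// exp_half_le1.
Qed.

Lemma geometric_boundX s (C : R) n : geometric_bound s C ->
  geometric_bound (fun k => s k ^+ n.+1) (C ^+ n.+1).
Proof.
move=> sC; elim: n => [|n ih]; first by move=> k; rewrite !expr1.
move=> k; rewrite exprS [C ^+ _]exprS; exact: (geometric_boundM sC ih).
Qed.

Context (s u : nat -> R) (A B : R) (sA : geometric_bound s A) (uB : geometric_bound u B).

Lemma ssum_pow4D (t : R) : ssum (fun k => (s k + t * u k) ^+ 4) =
  ssum (fun k => s k ^+ 4) + 4 * t * ssum (fun k => s k ^+ 3 * u k) +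
  6 * t ^+ 2 * ssum (fun k => s k ^+ 2 * u k ^+ 2) +
  4 * t ^+ 3 * ssum (fun k => s k * u k ^+ 3) + t ^+ 4 * ssum (fun k => u k ^+ 4).
Proof.
have g40 := geometric_boundX 3 sA.
have g31 := geometric_boundM (geometric_boundX 2 sA) uB.
have g22 := geometric_boundM (geometric_boundX 1 sA) (geometric_boundX 1 uB).
have g13 := geometric_boundM sA (geometric_boundX 2 uB).
have g04 := geometric_boundX 3 uB.
rewrite -(ssumZ (4 * t) g31) -(ssumZ (6 * t ^+ 2) g22).
rewrite -(ssumZ (4 * t ^+ 3) g13) -(ssumZ (t ^+ 4) g04).
have h31 := geometric_boundZ (4 * t) g31.
have h22 := geometric_boundZ (6 * t ^+ 2) g22.
have h13 := geometric_boundZ (4 * t ^+ 3) g13.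
have h04 := geometric_boundZ (t ^+ 4) g04.
have k1 := geometric_boundD g40 h31.
have k2 := geometric_boundD k1 h22; have k3 := geometric_boundD k2 h13.
rewrite -(ssumD g40 h31) -(ssumD k1 h22) -(ssumD k2 h13) -(ssumD k3 h04).
by congr ssum; apply/funext => k; ring.
Qed.

Lemma ssum_pow4_le : 0 <= ssum (fun k => s k ^+ 4) <= 2 * A ^+ 4.
Proof.
have g := geometric_boundX 3 sA; apply/andP; split.
  have s4 k : 0 <= s k ^+ 4 by exact: pow4_ge0.
  exact: le_trans (s4 0%N) (ssum_ge_term 0 g s4).
by apply: le_trans (ler_norm _) _; exact: ssum_bound.
Qed.

(** These are the terms of degree two to four of [ssum_pow4D], each bounded after [t ^+ 2] is taken
    out. *)
Lemma ssum_pow4_remainder (t : R) : `|t| <= 1 ->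
  `|ssum (fun k => (s k + t * u k) ^+ 4) - ssum (fun k => s k ^+ 4) -
    4 * t * ssum (fun k => s k ^+ 3 * u k)| <=
  t ^+ 2 * (12 * A ^+ 2 * B ^+ 2 + 8 * A * B ^+ 3 + 2 * B ^+ 4).
Proof.
move=> t1; rewrite ssum_pow4D.
have := ssum_bound (geometric_boundM (geometric_boundX 1 sA) (geometric_boundX 1 uB)).
have := ssum_bound (geometric_boundM sA (geometric_boundX 2 uB)).
have := ssum_bound (geometric_boundX 3 uB).
move: (ssum (fun k => u k ^+ 4)) (ssum (fun k => s k * u k ^+ 3))
  (ssum (fun k => s k ^+ 2 * u k ^+ 2)) => S4 S3 S2 h4 h3 h2.
set S0 := ssum _; set S1 := ssum _.
have -> : S0 + 4 * t * S1 + 6 * t ^+ 2 * S2 + 4 * t ^+ 3 * S3 + t ^+ 4 * S4 -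
    S0 - 4 * t * S1 =
  t ^+ 2 * (6 * S2 + t * (4 * S3) + t ^+ 2 * S4) by ring.
rewrite normrM ger0_norm ?sqr_ge0// ler_wpM2l ?sqr_ge0//.
apply: le_trans (ler_normD _ _) _; apply: lerD.
  apply: le_trans (ler_normD _ _) _; apply: lerD.
    by rewrite normrM ger0_norm//; move: h2; lra.
  rewrite normrM; apply: le_trans (ler_piMl _ t1) _ => //.
  by rewrite normrM ger0_norm//; move: h3; lra.
rewrite normrM; apply: le_trans (ler_piMl _ _) h4 => //.
by rewrite normrX exprn_ile1.
Qed.

End FourthPowerSum.

(** * The convex function [Phi] of a sequence of functionals *)

Section Phi.
Context {R : realType} {X : normedModType R}.
Context (b : X -> R) (d : R) (a : nat -> dual X) (e : nat -> X).
Hypotheses (b0 : forall x, 0 <= b x)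
  (ab : forall k x, `|a k x| <= d * 2^-1 ^+ k * b x)
  (ae : forall k i, `|a k (e i)| <= 2 * 2^-1 ^+ k * 2^-1 ^+ i).

Definition Phi (x : X) : R := ssum (fun k => a k x ^+ 4).

Lemma geometric_bound_family x : geometric_bound (fun k => a k x) (d * b x).
Proof. by move=> k; rewrite mulrAC. Qed.

Lemma geometric_bound_family_e i : geometric_bound (fun k => a k (e i)) (2 * 2^-1 ^+ i).
Proof. by move=> k; rewrite mulrAC. Qed.

Lemma Phi_bound x : 0 <= Phi x <= 2 * (d * b x) ^+ 4.
Proof. exact: ssum_pow4_le (geometric_bound_family x). Qed.

Lemma PhiZ (c : R) x : Phi (c *: x) = c ^+ 4 * Phi x.
Proof.
rewrite /Phi -(ssumZ _ (geometric_boundX 3 (geometric_bound_family x))).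
by congr ssum; apply/funext => k; rewrite dualZ exprMn.
Qed.

Lemma Phi_convex x x' l : 0 <= l <= 1 ->
  Phi (l *: x + (1 - l) *: x') <= l * Phi x + (1 - l) * Phi x'.
Proof.
move=> l01.
have g z := geometric_boundX 3 (geometric_bound_family z).
rewrite /Phi -(ssumZ l (g x)) -(ssumZ (1 - l) (g x')).
have hx := geometric_boundZ l (g x); have hx' := geometric_boundZ (1 - l) (g x').
rewrite -(ssumD hx hx'); apply: (ssum_le (g _) (geometric_boundD hx hx')) => k.
by rewrite dualD !dualZ pow4_convex.
Qed.

(** [pow4_midpoint] in every term: all gains are nonnegative, and only the [j]-th is kept. *)
Lemma Phi_midpoint x x' j : Phi (2^-1 *: (x + x')) + (a j (x - x') / 2) ^+ 4 <=
  (Phi x + Phi x') / 2.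
Proof.
have g z := geometric_boundX 3 (geometric_bound_family z).
have hx := geometric_boundZ 2^-1 (g x); have hx' := geometric_boundZ 2^-1 (g x').
have hm := geometric_boundZ (-1) (g (2^-1 *: (x + x'))).
have -> : (Phi x + Phi x') / 2 = 2^-1 * Phi x + 2^-1 * Phi x' by field.
rewrite /Phi -(ssumZ 2^-1 (g x)) -(ssumZ 2^-1 (g x')) -(ssumD hx hx').
rewrite addrC -lerBrDr -mulN1r -(ssumZ (-1) (g _)) -(ssumD (geometric_boundD hx hx') hm).
have term k : (a k (x - x') / 2) ^+ 4 <=
    2^-1 * a k x ^+ 4 + 2^-1 * a k x' ^+ 4 + -1 * a k (2^-1 *: (x + x')) ^+ 4.
  rewrite dualZ dualB dualD; have := pow4_midpoint (a k x) (a k x').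
  by rewrite (mulrC 2^-1 (_ + _)); lra.
apply: le_trans (term j) _.
apply: (ssum_ge_term j (geometric_boundD (geometric_boundD hx hx') hm)) => k.
by apply: le_trans (term k); exact: pow4_ge0.
Qed.

Lemma Phi_line x v (t : R) : Phi (x + t *: v) = ssum (fun k => (a k x + t * a k v) ^+ 4).
Proof. by congr ssum; apply/funext => k; rewrite dualD dualZ. Qed.

Lemma Phi_remainder x v (t : R) : `|t| <= 1 ->
  `|Phi (x + t *: v) - Phi x - 4 * t * ssum (fun k => a k x ^+ 3 * a k v)| <=
  t ^+ 2 * (12 * (d * b x) ^+ 2 * (d * b v) ^+ 2 + 8 * (d * b x) * (d * b v) ^+ 3 +
    2 * (d * b v) ^+ 4).
Proof.
move=> t1; rewrite Phi_line.
exact: (ssum_pow4_remainder (geometric_bound_family x) (geometric_bound_family v) t1).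
Qed.

Lemma Phi_smooth x v (s : R) : `|s| <= 1 ->
  Phi (x + s *: v) + Phi (x - s *: v) <= 2 * Phi x + 2 * s ^+ 2 *
    (12 * (d * b x) ^+ 2 * (d * b v) ^+ 2 + 8 * (d * b x) * (d * b v) ^+ 3 +
      2 * (d * b v) ^+ 4).
Proof.
move=> s1; have := Phi_remainder x v s1.
have sN1 : `|- s| <= 1 by rewrite normrN.
have := Phi_remainder x v sN1; rewrite scaleNr sqrrN.
rewrite !ler_norml => /andP[_ h1] /andP[_ h2].
by move: h1 h2; lra.
Qed.

Lemma Phi_bump x (eta : R) : 0 < eta -> exists N, forall i (t : R), (N <= i)%N ->
  `|t| <= 1 -> Phi (x + t *: e i) <= Phi x + eta.
Proof.
move=> eta0; pose A := d * b x.
have A0 : 0 <= A.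
  by have := geometric_bound_family x 0; rewrite expr0 mulr1; apply: le_trans.
(* With [h = 2^-i] the increase is at most [16 A^3 h + 48 A^2 h^2 + 64 A h^3 + 32 h^4], and the
   powers of [h] are at most [h]. *)
pose K := 16 * A ^+ 3 + 48 * A ^+ 2 + 64 * A + 32.
have K0 : 0 < K.
  by have := exprn_ge0 3 A0; have := exprn_ge0 2 A0; rewrite /K; lra.
have [N hN] := exp_half_small (divr_gt0 eta0 K0).
exists N => i t Ni t1; rewrite -lerBlDl.
have h1 : 0 <= (2^-1 : R) ^+ i <= 1 by rewrite exp_half_ge0 exp_half_le1.
have := hN i Ni; rewrite ler_pdivlMr//; apply: le_trans.
have gx := geometric_bound_family x; have ge := geometric_bound_family_e i.
rewrite -/A in gx.
have := ssum_pow4_remainder gx ge t1.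
have := ssum_bound (geometric_boundM (geometric_boundX 2 gx) ge).
rewrite -Phi_line -/(Phi x).
move: (2^-1 ^+ i) h1 (Phi _ - Phi x) (ssum _) => h /andP[h0 h1] D S.
move=> S1; rewrite ler_norml => /andP[_ D1].
have tS : 4 * t * S <= 8 * A ^+ 3 * (2 * h).
  have : `|t * S| <= 1 * (2 * (A ^+ 3 * (2 * h))) by rewrite normrM ler_pM.
  by rewrite mul1r ler_norml => /andP[_]; lra.
have t2 : t ^+ 2 <= 1 by rewrite -real_normK ?num_real// expr_le1.
have hh : h ^+ 2 <= h by rewrite expr2 ler_piMl.
have hhh : h ^+ 3 <= h by rewrite exprS ler_piMr// exprn_ile1.
have hhhh : h ^+ 4 <= h by rewrite exprS ler_piMr// exprn_ile1.
have E0 : 0 <= 12 * A ^+ 2 * (2 * h) ^+ 2 + 8 * A * (2 * h) ^+ 3 + 2 * (2 * h) ^+ 4.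
  have H0 : 0 <= 2 * h by lra.
  have A2 := exprn_ge0 2 A0.
  by apply: addr_ge0; first apply: addr_ge0; apply: mulr_ge0 (exprn_ge0 _ H0); lra.
have tE := ler_piMl E0 t2.
have A2 : 0 <= A ^+ 2 by rewrite exprn_ge0.
have a1 := ler_wpM2l A2 hh; have a2 := ler_wpM2l A0 hhh.
have -> : h * K = 16 * (A ^+ 3 * h) + 48 * (A ^+ 2 * h) + 64 * (A * h) + 32 * h.
  by rewrite /K; ring.
have EE : 12 * A ^+ 2 * (2 * h) ^+ 2 + 8 * A * (2 * h) ^+ 3 + 2 * (2 * h) ^+ 4 =
  48 * (A ^+ 2 * h ^+ 2) + 64 * (A * h ^+ 3) + 32 * h ^+ 4 by ring.
rewrite EE in D1 tE.
have E1 : 8 * A ^+ 3 * (2 * h) = 16 * (A ^+ 3 * h) by ring.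
rewrite E1 in tS; clear -D1 tE tS a1 a2 hhhh; lra.
Qed.

End Phi.

(** * Norm attaining functionals: a rigidity lemma *)

Section CubicRigidity.
Context {R : realType} {X : normedModType R} {I : Type} (F : I -> dual X).
Hypotheses (F_add : forall i j, exists k, F k = F i + F j)
  (F_opp : forall i, exists k, F k = - F i)
  (F_total : forall x, (forall i, F i x = 0) -> x = 0).

(* Polarizing the cubic identity over the additive group of the [F i], and
   using that the [F i] separate points, turns it into identities between
   vectors. *)
Lemma cubic_rigidity (x y z : X) (al be ga : R) : al != 0 -> be != 0 ->
  x != 0 -> y != 0 -> (forall s : R, y != s *: x) ->
  (forall i, ga * F i z ^+ 3 = al * F i x ^+ 3 + be * F i y ^+ 3) -> False.
Proof.
move=> al0 be0 x0 y0 yx cub.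
(* Polarization: [(s + t)^3 - (s - t)^3 - 2 t^3 = 6 s^2 t]. *)
have quad i j : ga * F i z ^+ 2 * F j z =
    al * F i x ^+ 2 * F j x + be * F i y ^+ 2 * F j y.
  have [k kE] := F_add i j; have [j' j'E] := F_opp j; have [l lE] := F_add i j'.
  have := cub k; have := cub l; have := cub j.
  rewrite kE lE !dual_addE j'E !dual_oppE => c1 c2 c3.
  have -> : ga * F i z ^+ 2 * F j z =
    (ga * (F i z + F j z) ^+ 3 - ga * (F i z - F j z) ^+ 3 -
      2 * (ga * F j z ^+ 3)) / 6 by field.
  by rewrite c1 c2 c3; field.
have tri i j k : ga * F i z * F j z * F k z =
    al * F i x * F j x * F k x + be * F i y * F j y * F k y.
  have [l lE] := F_add i j.
  have := quad l k; have := quad i k; have := quad j k.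
  rewrite lE !dual_addE => c1 c2 c3.
  have -> : ga * F i z * F j z * F k z =
    (ga * (F i z + F j z) ^+ 2 * F k z - ga * F i z ^+ 2 * F k z -
      ga * F j z ^+ 2 * F k z) / 2 by field.
  by rewrite c1 c2 c3; field.
have vec i j : (ga * F i z * F j z) *: z =
    (al * F i x * F j x) *: x + (be * F i y * F j y) *: y.
  apply/eqP; rewrite -subr_eq0; apply/eqP/F_total => k.
  by rewrite dualB dualD !dualZ tri subrr.
have indep (s t s' t' : R) : s *: x + t *: y = s' *: x + t' *: y -> s = s' /\ t = t'.
  move=> h; have h' : (s - s') *: x = (t' - t) *: y.
    by rewrite !scalerBl; apply/eqP; rewrite subr_eq addrAC eq_sym subr_eq addrC h addrC.
  have [tt|tt] := eqVneq (t' - t) 0.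
    move: h'; rewrite tt scale0r => /eqP; rewrite scaler_eq0 (negbTE x0) orbF subr_eq0.
    by move=> /eqP; move: tt => /eqP; rewrite subr_eq0 => /eqP -> ->.
  case/negP: (yx ((s - s') / (t' - t))); apply/eqP.
  by rewrite mulrC -scalerA h' scalerA mulVf// scale1r.
have nz v : v != 0 -> exists i, F i v != 0.
  move=> v0; have [//|no] := pselect (exists i, F i v != 0).
  case/negP: v0; apply/eqP/F_total => i.
  by have [//|Fi] := eqVneq (F i v) 0; case: no; exists i.
(* If one functional sees only [x] and another only [y], their sum sees both. *)
have [i [p0 r0]] : exists i, F i x != 0 /\ F i y != 0.
  have [i ix] := nz x x0; have [j jy] := nz y y0.
  have [iy|iy] := eqVneq (F i y) 0; last by exists i.
  have [jx|jx] := eqVneq (F j x) 0; last by exists j.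
  have [k kE] := F_add i j; exists k; rewrite kE !dual_addE iy jx.
  by rewrite addr0 add0r.
set p := F i x in p0; set r := F i y in r0; pose w := F i z.
(* [vec i i] and [vec i j] are multiples of the same [z]. Comparing coefficients of the independent
   [x] and [y] puts [F j x] and [F j y] in the ratio [p] to [r] for every [j], which makes [y] a
   multiple of [x]. *)
have key j : r * F j x = p * F j y.
  have e1 := vec i i; have e2 := vec i j; rewrite -/p -/r -/w in e1 e2.
  have [gw|gw] := eqVneq (ga * w) 0.
    have := e1; rewrite gw mul0r scale0r => h.
    have [|] := indep 0 0 (al * p * p) (be * r * r).
      by rewrite !scale0r addr0.
    by move=> /esym/eqP; rewrite !mulf_eq0 (negbTE al0) (negbTE p0).
  have h : (ga * w * w) *: ((ga * w * F j z) *: z) =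
      (ga * w * F j z) *: ((ga * w * w) *: z).
    by rewrite !scalerA mulrC.
  rewrite e1 e2 !scalerDr !scalerA in h; have [h1 h2] := indep _ _ _ _ h.
  have g1 : w * F j x = p * F j z.
    apply: (mulfI gw); apply: (mulfI (mulf_neq0 al0 p0)).
    move: h1; rewrite !mulrA => h1.
    by rewrite [LHS](_ : _ = ga * w * w * al * p * F j x); [rewrite h1|]; ring.
  have g2 : w * F j y = r * F j z.
    apply: (mulfI gw); apply: (mulfI (mulf_neq0 be0 r0)).
    move: h2; rewrite !mulrA => h2.
    by rewrite [LHS](_ : _ = ga * w * w * be * r * F j y); [rewrite h2|]; ring.
  have w0 : w != 0 by apply: contra gw => /eqP ->; rewrite mulr0.
  apply: (mulfI w0).
  by rewrite mulrCA g1 [RHS]mulrCA g2 mulrCA.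
case/negP: (yx (r / p)); apply/eqP; apply/eqP; rewrite -subr_eq0; apply/eqP.
apply: F_total => j; rewrite dualB dualZ mulrAC key.
by rewrite mulrAC divff// mul1r subrr.
Qed.

End CubicRigidity.

(** * The renorming *)

Section Geometry.
Context {R : realType} {X : normedModType R}.
Context (b : X -> R) (m M d : R) (xs : nat -> X) (y : nat -> X) (cs : nat -> R)
  (e : nat -> X) (T : {linear X -> c0 R}) (fs : nat -> dual X) (a : nat -> dual X).
Hypotheses (bD : forall x x', b (x + x') <= b x + b x')
  (bZ : forall (c : R) x, b (c *: x) = `|c| * b x) (b0 : forall x, 0 <= b x)
  (m0 : 0 < m) (M0 : 0 < M)
  (bm : forall x, `|x| <= m * b x) (bM : forall x, b x <= M * `|x|)
  (d0 : 0 < d) (d1 : d <= 12^-1)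
  (xs_dense : forall x (eps : R), 0 < eps -> exists n, `|x - xs n| < eps)
  (yE : forall i, y i = cs i *: xs i) (cs0 : forall i, cs i != 0)
  (y_le : forall i, b (y i) <= d / 2 * 2^-1 ^+ i * 2^-1 ^+ i)
  (Tb : forall x, `|T x| <= b x)
  (be1 : forall i, 1 <= b (e i))
  (b_bump : forall x i (t : R), b (x + t *: e i) <= Num.max (b x) (`|t| + `|T x i|))
  (e_null : forall (f : dual X) (eps : R), 0 < eps ->
     exists N, forall n, (N <= n)%N -> `|f (e n)| <= eps)
  (fs_total : forall x, (forall j, fs j x = 0) -> x = 0)
  (ab : forall k x, `|a k x| <= d * 2^-1 ^+ k * b x)
  (ae : forall k i, `|a k (e i)| <= 2 * 2^-1 ^+ k * 2^-1 ^+ i)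
  (a_indep : forall (c : nat -> R) (C : R), (forall k, `|c k| <= C) ->
        (exists N, forall i, (N <= i)%N -> ssum (fun k => c k * a k (e i)) = 0) ->
        forall k, c k = 0)
  (a_approx : forall s (eps : R), 0 < eps -> exists k (c : R),
        forall x, `|int_comb fs s x - c * a k x| <= eps * b x).

Let d13 : d < 3^-1.
Proof. by apply: le_lt_trans d1 _; rewrite ltf_pV2 ?posrE// ltr_nat. Qed.

Local Notation N := (infconv b y).

Definition Psi (x : X) := N x + Phi a x.

Lemma PsiZ (c : R) x : Psi (c *: x) = c ^+ 4 * Psi x.
Proof. by rewrite /Psi (infconvZ y bZ) (PhiZ ab) mulrDr. Qed.

Lemma Psi_convex x x' l : 0 <= l <= 1 ->
  Psi (l *: x + (1 - l) *: x') <= l * Psi x + (1 - l) * Psi x'.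
Proof.
move=> l01; rewrite /Psi !mulrDr addrACA.
by apply: lerD; [exact: infconv_convex|exact: Phi_convex].
Qed.

Lemma Psi_ge_b x : ((1 - d) * b x) ^+ 4 <= Psi x.
Proof.
rewrite -[leLHS]addr0; apply: lerD; last by case/andP: (Phi_bound ab x).
exact: infconv_lb.
Qed.

Lemma Psi_le_b x : Psi x <= (1 + d) * b x ^+ 4.
Proof.
rewrite mulrDl mul1r; apply: lerD; first exact: infconv_ub.
have /andP[_ h] := Phi_bound ab x; apply: le_trans h _.
rewrite exprMn mulrA ler_wpM2r ?pow4_ge0//.
have d2 : d ^+ 2 <= 1 by rewrite exprn_ile1 ?(ltW d0)//; move: (d1); lra.
have d20 : 0 <= d ^+ 2 by exact: sqr_ge0.
have -> : 2 * d ^+ 4 = d * (2 * d * d ^+ 2) by ring.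
rewrite ler_piMr ?(ltW d0)//; apply: mulr_ile1 => //.
  by move: (d0); lra.
by move: (d1); lra.
Qed.

Lemma Psi_equiv x : ((1 - d) * m^-1 * `|x|) ^+ 4 <= Psi x <= (2 * M * `|x|) ^+ 4.
Proof.
have d10 : 0 <= 1 - d by move: (d13); lra.
apply/andP; split.
  apply: le_trans (Psi_ge_b x).
  rewrite ler_pXn2r ?nnegrE ?mulr_ge0 ?invr_ge0 ?(ltW m0)//.
  by rewrite -mulrA ler_wpM2l// ler_pdivrMl.
apply: le_trans (Psi_le_b x) _.
have -> : (2 * M * `|x|) ^+ 4 = 16 * (M * `|x|) ^+ 4 by ring.
apply: ler_pM; rewrite ?pow4_ge0//; [by move: (d0); lra|by move: (d13); lra|].
by rewrite ler_pXn2r ?nnegrE ?mulr_ge0 ?(ltW M0).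
Qed.

Lemma Psi_midpoint x x' j :
  Psi (2^-1 *: (x + x')) + (a j (x - x') / 2) ^+ 4 <= (Psi x + Psi x') / 2.
Proof.
have h : 0 <= (2^-1 : R) <= 1 by lra.
have := @infconv_convex R X b y bD bZ b0 x x' _ h; have := Phi_midpoint ab x x' j.
have -> : 1 - 2^-1 = 2^-1 :> R by lra.
rewrite -scalerDr /Psi; lra.
Qed.

Lemma b_le_Psi x (r : R) : 0 <= r -> Psi x <= r ^+ 4 -> (1 - d) * b x <= r.
Proof.
move=> r0 xr; have d10 : 0 <= 1 - d by move: (d13); lra.
have := le_trans (Psi_ge_b x) xr; rewrite pow4_le// ger0_norm//.
exact: mulr_ge0.
Qed.

(** The constant depends on the direction [y j] but not on [x] in the unit ball: [dual_agree] needs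
    this uniformity. *)
Lemma Psi_smooth j : exists C : R, 0 <= C /\ forall x (s : R), Psi x <= 1 -> `|s| <= 1 ->
  Psi (x + s *: y j) + Psi (x - s *: y j) <= 2 * Psi x + C * s ^+ 2.
Proof.
pose B := d * b (y j); have B0 : 0 <= B by rewrite mulr_ge0// ltW.
exists (28 + 2 * (12 * B ^+ 2 + 8 * B ^+ 3 + 2 * B ^+ 4)); split=> [|x s x1 s1].
  by have := exprn_ge0 2 B0; have := exprn_ge0 3 B0; have := exprn_ge0 4 B0; lra.
have s20 : 0 <= s ^+ 2 by exact: sqr_ge0.
have := infconv_smooth b y x j s1; have := Phi_smooth ab x (y j) s1.
rewrite -/B /Psi.
have N1 : N x <= 1.
  by apply: le_trans x1; rewrite lerDl; case/andP: (Phi_bound ab x).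
have A0 : 0 <= d * b x by rewrite mulr_ge0// ltW.
have A1 : d * b x <= 1.
  have := @b_le_Psi x 1 ler01; rewrite expr1n => /(_ x1) h.
  apply: le_trans h; rewrite ler_wpM2r//; move: (d13); lra.
move: (d * b x) A0 A1 => A A0 A1.
have A2 : A ^+ 2 <= 1 by rewrite exprn_ile1.
have a1 := ler_wpM2l s20 N1.
have a2 : A ^+ 2 * B ^+ 2 <= B ^+ 2 by rewrite ler_piMl// exprn_ge0.
have a3 : A * B ^+ 3 <= B ^+ 3 by rewrite ler_piMl// exprn_ge0.
have h2 := ler_wpM2l s20 a2; have h3 := ler_wpM2l s20 a3.
lra.
Qed.

Lemma Psi_norm : exists q : equiv_norm X,
  (forall x, 0 <= q x) /\ forall x, q x ^+ 4 = Psi x.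
Proof.
have md : 0 < (1 - d) * m^-1 by rewrite mulr_gt0 ?invr_gt0//; move: (d13); lra.
have M2 : 0 <= 2 * M by rewrite mulr_ge0// ltW.
exact: (fourth_root_norm Psi_convex PsiZ md M2 Psi_equiv).
Qed.

Context (q : equiv_norm X).
Hypotheses (q0 : forall x, 0 <= q x) (q4 : forall x, q x ^+ 4 = Psi x).

Local Notation V := (renormed q).

Lemma renormedE (x : V) : `|x| = q x. Proof. by []. Qed.

(** Equivalent norms have the same continuous functionals; only the types and norms of the two duals
    differ. *)
Lemma renormed_dual (f : dual X) : exists g : dual V, g =1 f.
Proof.
have [k [K [k0 hq]]] := eqnorm_equiv q.
apply: (@dual_ex R V (f : V -> R^o) (`|f| * k^-1)); first exact: (dual_linear f).
move=> x; apply: le_trans (dual_apply_le f x) _; rewrite -mulrA ler_wpM2l//.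
by rewrite ler_pdivlMl//; have /andP[] := hq x.
Qed.

Lemma dual_renormed (g : dual V) : exists f : dual X, f =1 g.
Proof.
have [k [K [k0 hq]]] := eqnorm_equiv q.
apply: (@dual_ex R X (g : X -> R^o) (`|g| * K)); first exact: (dual_linear g).
move=> x; apply: le_trans (dual_apply_le g x) _; rewrite -mulrA ler_wpM2l//.
by have /andP[] := hq x.
Qed.

Lemma family_total x : (forall k, a k x = 0) -> x = 0.
Proof.
move=> ax; apply: fs_total => j; apply/eqP; rewrite -normr_le0.
apply/ler_addgt0Pr => eps eps0; rewrite add0r.
have bx1 : 0 < b x + 1 by rewrite ltr_wpDl.
have [k [c hc]] := a_approx [:: (j, 1)] (divr_gt0 eps0 bx1).
have := hc x; rewrite ax mulr0 subr0 int_comb1 => h; apply: le_trans h _.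
by rewrite -mulrA ler_piMr ?(ltW eps0)// mulrC ler_pdivrMr// mul1r lerDl.
Qed.

(** When two points and their midpoint are on the sphere, [Psi_midpoint] forces every [a j (x - x')]
    to vanish. *)
Lemma renormed_strictly_convex : strictly_convex V.
Proof.
apply: strictly_convex_midpoint => x x' x1 x'1 xx'.
apply/eqP; rewrite -subr_eq0; apply/eqP/family_total => j.
have := Psi_midpoint x x' j; rewrite -!q4.
have -> : q (2^-1 *: (x + x')) = 1.
  by rewrite eqnormZ (xx' : q (x + x') = 2) ger0_norm ?invr_ge0// mulVf.
rewrite (x1 : q x = 1) (x'1 : q x' = 1) !expr1n => h.
have : (a j (x - x') / 2) ^+ 4 <= 0 ^+ 4 by rewrite [0 ^+ 4]expr0n/=; lra.
rewrite pow4_le// normr_le0 mulf_eq0 invr_eq0 pnatr_eq0 orbF.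
by move=> /eqP.
Qed.

(** Uniform smoothness along the [y j] makes the two functionals agree there, and the multiples [xs]
    of the [y j] are dense. *)
Lemma dual_strictly_convex : strictly_convex (dual V).
Proof.
apply: strictly_convex_midpoint => f g f1 g1 fg.
have agree j : f (y j) = g (y j).
  apply: (dual_agree _ f1 g1 fg) => eps eps0.
  have [C [C0 hC]] := Psi_smooth j.
  have C1 : 0 < C + 1 by rewrite ltr_wpDl.
  (* The [4] is the slope in [pow4_tangent]: the two norms satisfy
     [4 * (Q1 + Q2) - 6 <= 2 + C * s ^+ 2]. *)
  pose s := Num.min 1 (4 * eps / (C + 1)).
  have s0 : 0 < s by rewrite lt_min ltr01 divr_gt0// mulr_gt0.
  exists s => // x x1.
  have Px : Psi x <= 1 by rewrite -q4 exprn_ile1.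
  have s1 : `|s| <= 1 by rewrite gtr0_norm// ge_min lexx.
  have := hC x s Px s1; rewrite -!q4.
  have := pow4_tangent (q (x + s *: y j)); have := pow4_tangent (q (x - s *: y j)).
  have qx4 : q x ^+ 4 <= 1 by rewrite q4.
  have sC : s * C <= 4 * eps.
    have : s <= 4 * eps / (C + 1) by rewrite ge_min lexx orbT.
    rewrite ler_pdivlMr// => h; apply: le_trans h; rewrite ler_wpM2l ?(ltW s0)//.
    by rewrite lerDl.
  have := ler_wpM2l (ltW s0) sC; rewrite !renormedE.
  move: (q (x + _)) (q (x - _)) => Q1 Q2; lra.
apply/val_inj/funext => x; apply/eqP; rewrite -subr_eq0 -normr_le0.
have [h hE] := dual_renormed (f - g).
have hx n : h (xs n) = 0.
  have := agree n; rewrite yE !dualZ => /(mulfI (cs0 n)) fgn.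
  by rewrite hE dual_subE fgn subrr.
apply/ler_addgt0Pr => eps eps0; rewrite add0r -[X in `|X|]/((f - g) x) -hE.
have h1 : 0 < `|h| + 1 by rewrite ltr_wpDl.
have [n hn] := xs_dense x (divr_gt0 eps0 h1).
have -> : h x = h (x - xs n) by rewrite dualB hx subr0.
apply: le_trans (dual_apply_le _ _) _.
apply: le_trans (ler_wpM2l _ (ltW hn)) _ => //.
by rewrite mulrCA ler_piMr ?(ltW eps0)// ler_pdivrMr// mul1r lerDl.
Qed.

Lemma renormed_smooth : smooth V.
Proof. exact: smooth_of_dual dual_strictly_convex. Qed.

Lemma q_ge_b x : (1 - d) * b x <= q x.
Proof. by apply: b_le_Psi => //; rewrite q4. Qed.

(** An almost norming [x] is moved by [t e_i] and [- t e_i] with [t = (1 - 3 d) b x] and [i] large: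
    the infimal convolution does not grow, [Phi] grows by at most [eta], and [f] changes by at most
    [eta]. Division by [1 + eta] returns to the ball. *)
Lemma slice_pair (f : dual V) (alpha : R) : f != 0 -> 0 < alpha -> exists x x' : V,
  [/\ `|x| <= 1, `|x'| <= 1, `|f| - alpha < f x, `|f| - alpha < f x' &
      2 - 12 * d <= `|x - x'|].
Proof.
move=> f0 al0; have l0 : 0 < `|f| by rewrite normr_gt0.
set l := `|f| in l0 *.
have [x [x1 fx]] : exists x : V, q x = 1 /\ l - alpha / 4 < f x.
  (* The bound [l / 2] makes [f x] positive, so [x] is nonzero and scaling it up to the sphere does
     not decrease [f x]. *)
  have al'0 : 0 < Num.min (alpha / 4) (l / 2) by rewrite lt_min !divr_gt0.
  have [x [x1 fx]] := dual_approx f al'0; rewrite -/l in fx.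
  have fxl : l / 2 < f x.
    have : Num.min (alpha / 4) (l / 2) <= l / 2 by rewrite ge_min lexx orbT.
    by lra.
  have fxa : l - alpha / 4 < f x.
    have : Num.min (alpha / 4) (l / 2) <= alpha / 4 by rewrite ge_min lexx.
    by lra.
  have fx0 : 0 < f x by apply: lt_trans fxl; rewrite divr_gt0.
  have qx0 : 0 < q x.
    rewrite lt_neqAle q0 andbT eq_sym; apply: contraTneq fx0 => /eqnorm0_eq0 ->.
    by rewrite dual0 ltxx.
  exists ((q x)^-1 *: x); split.
    by rewrite eqnormZ ger0_norm ?invr_ge0// mulVf// gt_eqF.
  apply: lt_le_trans fxa _; rewrite dualZ ler_peMl ?(ltW fx0)//.
  by rewrite invf_ge1.
have d10 : 0 <= 1 - d by move: (d13); lra.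
have Px1 : Psi x = 1 by rewrite -q4 x1 expr1n.
have bx_lb : 1 - d <= b x.
  (* Otherwise [Psi x] would be smaller than [(1 + d) * (1 - d) ^+ 4 <= 1]. *)
  rewrite leNgt; apply/negP => bx.
  have : b x ^+ 4 < (1 - d) ^+ 4 by rewrite ltr_pXn2r ?nnegrE.
  have := Psi_le_b x; rewrite Px1 => h1 h2.
  have : (1 + d) * b x ^+ 4 < (1 + d) * (1 - d) ^+ 4.
    by rewrite ltr_pM2l//; move: (d0); lra.
  have -> : (1 + d) * (1 - d) ^+ 4 = (1 - d ^+ 2) * (1 - d) ^+ 3 by ring.
  have : (1 - d ^+ 2) * (1 - d) ^+ 3 <= 1.
    have d20 : 0 <= d ^+ 2 by exact: sqr_ge0.
    have d21 : d ^+ 2 <= 1 by rewrite exprn_ile1 ?(ltW d0)//; move: (d13); lra.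
    apply: mulr_ile1; rewrite ?exprn_ge0 ?exprn_ile1//; move: (d0); lra.
  by lra.
have bx0 : 0 < b x by apply: lt_le_trans bx_lb; move: (d13); lra.
have bx_ub : (1 - d) * b x <= 1 by rewrite -[leRHS]x1; exact: q_ge_b.
pose t := (1 - 3 * d) * b x.
have t0 : 0 <= t by rewrite mulr_ge0//; move: (d13); lra.
have t1 : t <= 1.
  by apply: le_trans bx_ub; rewrite ler_wpM2r//; move: (d0); lra.
have l1 : 0 < 1 + l by rewrite addr_gt0.
pose eta := Num.min d (alpha / (2 * (1 + l))).
have eta0 : 0 < eta by rewrite lt_min d0 divr_gt0// mulr_gt0.
have etad : eta <= d by rewrite ge_min lexx.
have etaa : eta * (1 + l) <= alpha / 2.
  have : eta <= alpha / (2 * (1 + l)) by rewrite ge_min lexx orbT.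
  by rewrite ler_pdivlMr ?mulr_gt0//; lra.
have [N1 hN1] := infconv_bump bD bZ b0 d0 d13 y_le Tb b_bump bx0.
have [N2 hN2] := Phi_bump ab ae x eta0.
have [f' f'E] := dual_renormed f; have [N3 hN3] := e_null f' eta0.
pose i := maxn N1 (maxn N2 N3).
have i1 : (N1 <= i)%N by rewrite leq_maxl.
have i2 : (N2 <= i)%N by rewrite !leq_max leqnn orbT.
have i3 : (N3 <= i)%N by rewrite !leq_max leqnn !orbT.
have fe : `|f (e i)| <= eta by have := hN3 i i3; rewrite f'E.
have bump (s : R) : `|s| <= t -> q (x + s *: e i) <= 1 + eta /\
    l - alpha < (1 + eta)^-1 * f (x + s *: e i).
  move=> st; split.
    rewrite -[leLHS]ger0_norm// -pow4_le ?addr_ge0 ?(ltW eta0)// q4.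
    apply: le_trans (_ : 1 + eta <= _).
      have := hN1 i s i1 st; have := hN2 i s i2 (le_trans st t1).
      by move: Px1; rewrite /Psi; lra.
    have : 1 <= (1 + eta) ^+ 3 by rewrite exprn_ege1// lerDl ltW.
    have e1 : 0 <= 1 + eta by rewrite addr_ge0// ltW.
    by move=> h; have := ler_wpM2l e1 h; rewrite mulr1 -exprS.
  have e1 : 0 < 1 + eta by rewrite addr_gt0.
  rewrite ltr_pdivlMl// dualD dualZ.
  have : `|s * f (e i)| <= 1 * eta by rewrite normrM ler_pM// (le_trans st).
  rewrite mul1r ler_norml => /andP[h _].
  have := mulr_gt0 eta0 al0; lra.
have tt : `|t| <= t by rewrite ger0_norm.
have tNt : `|- t| <= t by rewrite normrN ger0_norm.
have e1 : 0 < 1 + eta by rewrite addr_gt0.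
have [a1 a2] := bump t tt; have [c1 c2] := bump (- t) tNt.
have ball (z : V) : q z <= 1 + eta -> q ((1 + eta)^-1 *: z) <= 1.
  by move=> z1; rewrite eqnormZ ger0_norm ?invr_ge0 ?(ltW e1)// ler_pdivrMl// mulr1.
exists ((1 + eta)^-1 *: (x + t *: e i)), ((1 + eta)^-1 *: (x + - t *: e i)).
split; [exact: ball|exact: ball|by rewrite dualZ|by rewrite dualZ|].
rewrite -scalerBr renormedE eqnormZ ger0_norm ?invr_ge0 ?(ltW e1)//.
have -> : x + t *: e i - (x + - t *: e i) = (2 * t) *: e i.
  by rewrite opprD addrACA subrr add0r -scaleNr opprK -scalerDl; congr (_ *: _); ring.
have t20 : 0 <= 2 * t by rewrite mulr_ge0.
rewrite eqnormZ (ger0_norm t20) [leRHS]mulrC ler_pdivlMr//.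
have qe : 1 - d <= q (e i).
  by apply: le_trans (q_ge_b _); rewrite ler_peMr.
have ta : (1 - 3 * d) * (1 - d) <= t by rewrite ler_wpM2l//; move: (d13); lra.
have h3 : (1 - 3 * d) * (1 - d) * (1 - d) <= t * q (e i).
  by apply: ler_pM => //; rewrite mulr_ge0//; move: (d13); lra.
(* As [eta <= d], the distance is at least [2 (1 - 3 d) (1 - d)^2 / (1 + d)], which is at least
   [2 - 12 d]. *)
apply: le_trans (_ : (1 + d) * (2 - 12 * d) <= _).
  by rewrite mulrC ler_wpM2r ?lerD2l//; move: (d1); lra.
rewrite -mulrA; move: h3.
have -> : (1 - 3 * d) * (1 - d) * (1 - d) =
  (1 + d) * (1 - 6 * d) + d ^+ 2 * (13 - 3 * d) by ring.
have : 0 <= d ^+ 2 * (13 - 3 * d) by apply: mulr_ge0 (sqr_ge0 _) _; move: (d13); lra.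
have -> : (1 + d) * (2 - 12 * d) = 2 * ((1 + d) * (1 - 6 * d)) by ring.
move: (_ * (13 - _)) (_ * (1 - 6 * _)) (t * _) => P1 P2 P3; lra.
Qed.

Lemma renormed_slice_diameter (f : dual V) (alpha : R) : f != 0 -> 0 < alpha ->
  ((2 - 12 * d)%:E <= diameter (slice f alpha))%E.
Proof.
move=> f0 al0; have [x [x' [x1 x'1 fx fx' h]]] := slice_pair f0 al0.
have supf : sup (f @` @unit_ball R V) <= `|f|.
  apply: ge_sup; first by exists (f 0), 0 => //; rewrite /unit_ball /= normr0.
  move=> _ [z z1 <-]; apply: le_trans (dual_apply_ub _ _) _.
  by rewrite ler_piMr.
apply: ereal_sup_ge; exists `|x - x'|%:E; last by rewrite lee_fin.
exists (x, x') => //; split; split=> //=.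
- by apply: le_lt_trans fx; rewrite lerB.
- by apply: le_lt_trans fx'; rewrite lerB.
Qed.

Lemma dual_nontrivial : exists f : dual V, f != 0.
Proof.
have e0 : e 0%N != 0.
  apply/eqP => e0; have := be1 0%N; rewrite e0.
  by have := bZ 0 0; rewrite scale0r normr0 mul0r => ->; rewrite ler10.
have [f [_ fe]] := norming (e 0%N : V).
exists f; apply/eqP => f0; move: fe; rewrite f0 => /esym/eqP.
by rewrite normr_eq0 (negbTE e0).
Qed.

Lemma dual_rough : rough (dual V) (2 - 12 * d).
Proof.
apply: rough_of_slices; [by move: (d0); lra|exact: dual_nontrivial|].
by move=> f alpha f0 al0; exact: slice_pair.
Qed.

(** Dividing by small [t] of either sign leaves no room for [z]; the test value [s] keeps [C * s]
    below half the absolute value of [z]. *)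
Lemma linear_le_quadratic (z C r : R) : 0 < r ->
  (forall t, `|t| <= r -> t * z <= C * t ^+ 2) -> z = 0.
Proof.
move=> r0 h; apply/eqP; apply: contraT => z0.
have nz : 0 < `|z| by rewrite normr_gt0.
have C1 : 0 < 2 * (`|C| + 1) by rewrite mulr_gt0// ltr_wpDl.
pose s := Num.min r (`|z| / (2 * (`|C| + 1))).
have s0 : 0 < s by rewrite lt_min r0 divr_gt0.
have sr : s <= r by rewrite ge_min lexx.
have sC : s * (2 * (`|C| + 1)) <= `|z|.
  by rewrite -ler_pdivlMr// ge_min lexx orbT.
have := h (Num.sg z * s); rewrite normrM normr_sg z0 mul1r gtr0_norm// => /(_ sr).
rewrite exprMn sqr_sg z0 mul1r mulrAC -normrEsg.
have : C * s ^+ 2 <= `|C| * s ^+ 2 by rewrite ler_wpM2r ?sqr_ge0// ler_norm.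
have : s * (s * (2 * (`|C| + 1))) <= s * `|z| by rewrite ler_wpM2l// ltW.
have : 0 < s ^+ 2 by rewrite exprn_gt0.
have : 0 <= `|C| * s ^+ 2 by rewrite mulr_ge0// sqr_ge0.
move: (`|C|) (`|z|) => c w; rewrite expr2; lra.
Qed.

(* Moving [x] along [e i] does not increase the nonsmooth part of [Psi], so
   [f (e i)] is given by the derivative of [Phi]. *)
Lemma norm_attaining_coords (f : dual V) : f != 0 -> norm_attaining f ->
  exists (x : X) (l : R) (n : nat), [/\ x != 0, 0 < l &
    forall i, (n <= i)%N -> f (e i) = l * ssum (fun k => a k x ^+ 3 * a k (e i))].
Proof.
move=> f0 [x0 [x01 fx0]]; set l := `|f| in fx0.
have l0 : 0 < l by rewrite normr_gt0.
have [x [qx fx]] : exists x : V, q x = 1 /\ f x = l.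
  have [h|h] := leP 0 (f x0); first by exists x0; rewrite -fx0 ger0_norm.
  by exists (- x0); rewrite -fx0 ltr0_norm// dualN -renormedE normrN.
have bx0 : 0 < b x.
  rewrite lt_neqAle b0 andbT eq_sym; apply/eqP => bx.
  have := Psi_le_b x; rewrite -q4 qx bx expr1n expr0n mulr0.
  by rewrite ler10.
have [n hn] := infconv_bump bD bZ b0 d0 d13 y_le Tb b_bump bx0.
exists x, l, n; split=> // [|i ni].
  apply/eqP => x0'; move: bx0; rewrite x0'; have := bZ 0 0.
  by rewrite scale0r normr0 mul0r => ->; rewrite ltxx.
set S := ssum _; pose B := d * b (e i); pose A := d * b x.
pose C := 12 * A ^+ 2 * B ^+ 2 + 8 * A * B ^+ 3 + 2 * B ^+ 4.
have r0 : 0 < Num.min 1 ((1 - 3 * d) * b x).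
  by rewrite lt_min ltr01 mulr_gt0//; move: (d13); lra.
(* Divide [f (x + t *: e i) ^+ 4 <= l ^+ 4 * Psi (x + t *: e i)] by [l ^+ 4]: the left side is at
   least [1 + 4 t f(e_i) / l] by [pow4_tangent], the right side at most [1 + 4 t S + C t^2]. *)
have fle : 4 * (f (e i) / l - S) = 0.
  apply: (@linear_le_quadratic _ C _ r0) => t; rewrite le_min => /andP[t1 tb].
  have := hn i t ni tb; have := Phi_remainder ab x (e i) t1.
  rewrite -/S -/A -/B -/C ler_norml => /andP[_ h1] h2.
  have P1 : N x + Phi a x = 1 by rewrite -[LHS]/(Psi x) -q4 qx expr1n.
  have := pow4_tangent (1 + t * (f (e i) / l)).
  have fxe : f (x + t *: e i) = l * (1 + t * (f (e i) / l)).
    by rewrite dualD dualZ fx; field; rewrite gt_eqF.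
  have : `|f (x + t *: e i)| <= l * q (x + t *: e i) by exact: dual_apply_le.
  have l0' := ltW l0.
  rewrite -pow4_le ?mulr_ge0// fxe !exprMn ler_pM2l ?exprn_gt0// q4 /Psi.
  lra.
have : f (e i) / l = S by lra.
by move=> <-; rewrite mulrC divfK// gt_eqF.
Qed.

(** At [e i] with [i] large, the relation between [f], [g] and [h] says that a series in the
    [a k (e i)] vanishes, so independence gives the cubic identity for each [a k]. Being homogeneous
    it holds for their multiples, and it passes to the limits [int_comb fs s]. *)
Lemma coords_combination (f g h : dual V) (al be lf lg lh : R) (x x' z : X) :
  h = al *: f + be *: g ->
  (exists n, forall i, (n <= i)%N -> f (e i) = lf * ssum (fun k => a k x ^+ 3 * a k (e i))) ->
  (exists n, forall i, (n <= i)%N -> g (e i) = lg * ssum (fun k => a k x' ^+ 3 * a k (e i))) ->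
  (exists n, forall i, (n <= i)%N -> h (e i) = lh * ssum (fun k => a k z ^+ 3 * a k (e i))) ->
  forall s, lh * int_comb fs s z ^+ 3 =
    al * lf * int_comb fs s x ^+ 3 + be * lg * int_comb fs s x' ^+ 3.
Proof.
move=> hE [nf hf] [ng hg] [nh hh].
have gb w : geometric_bound (fun k => a k w) (d * b w) by exact: geometric_bound_family.
have gb3 w := geometric_boundX 2 (gb w).
have ak k : lh * a k z ^+ 3 = al * lf * a k x ^+ 3 + be * lg * a k x' ^+ 3.
  pose c k := lh * a k z ^+ 3 + (- (al * lf) * a k x ^+ 3 + - (be * lg) * a k x' ^+ 3).
  suff : c k = 0 by rewrite /c; lra.
  have gc := geometric_boundD (geometric_boundZ lh (gb3 z)) (geometric_boundD
    (geometric_boundZ (- (al * lf)) (gb3 x)) (geometric_boundZ (- (be * lg)) (gb3 x'))).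
  apply: (a_indep (C := _)) => [j|].
    apply: le_trans (gc j) _.
    apply: ler_piMr; last exact: exp_half_le1.
    by have := gc 0%N; rewrite expr0 mulr1; apply: le_trans.
  exists (maxn nf (maxn ng nh)) => i; rewrite !geq_max => /and3P[fi gi hi].
  have ge3 w := geometric_boundM (gb3 w) (gb (e i)).
  have -> : (fun j => c j * a j (e i)) = (fun j => lh * (a j z ^+ 3 * a j (e i)) +
     (- (al * lf) * (a j x ^+ 3 * a j (e i)) + - (be * lg) * (a j x' ^+ 3 * a j (e i)))).
    by apply/funext => j; rewrite /c; ring.
  have hx := geometric_boundZ (- (al * lf)) (ge3 x).
  have hx' := geometric_boundZ (- (be * lg)) (ge3 x').
  rewrite (ssumD (geometric_boundZ lh (ge3 z)) (geometric_boundD hx hx')) (ssumD hx hx').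
  rewrite (ssumZ _ (ge3 z)) (ssumZ _ (ge3 x)) (ssumZ _ (ge3 x')) -hh//.
  rewrite !mulNr -!mulrA -hf// -hg// hE dual_addE !dual_scaleE; ring.
move=> s; set F := int_comb fs s.
have [kc hkc] : exists kc : nat -> nat * R, forall n w,
    `|F w - (kc n).2 * a (kc n).1 w| <= 2^-1 ^+ n * b w.
  have /choice[kc hkc] : forall n, exists kc : nat * R, forall w,
      `|F w - kc.2 * a kc.1 w| <= 2^-1 ^+ n * b w.
    by move=> n; have [k [c hc]] := a_approx s (@exp_half_gt0 R n); exists (k, c).
  by exists kc.
have cvF w : (kc n).2 * a (kc n).1 w @[n --> \oo] --> (F w : R^o).
  apply/cvgrPdist_le => eps eps0.
  have bw : 0 < b w + 1 by rewrite ltr_wpDl.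
  have [n hn] := exp_half_small (divr_gt0 eps0 bw).
  exists n => // j nj /=; apply: le_trans (hkc j w) _.
  have := hn j nj; rewrite ler_pdivlMr// => hb; apply: le_trans hb.
  by rewrite ler_wpM2l ?exp_half_ge0// lerDl.
have cvF3 (c : R) w :
    c * ((kc n).2 * a (kc n).1 w) ^+ 3 @[n --> \oo] --> (c * F w ^+ 3 : R^o).
  have h3 : ((kc n).2 * a (kc n).1 w) ^+ 3 @[n --> \oo] --> (F w ^+ 3 : R^o).
    by apply: (cvgM (cvF w) (cvgM (cvF w) (cvF w))).
  exact: cvgM (cvg_cst _) h3.
have := cvF3 lh z.
have -> : (fun n => lh * ((kc n).2 * a (kc n).1 z) ^+ 3) =
    (fun n => al * lf * ((kc n).2 * a (kc n).1 x) ^+ 3 +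
      be * lg * ((kc n).2 * a (kc n).1 x') ^+ 3).
  apply/funext => n; rewrite !exprMn mulrCA ak; ring.
move=> c1.
have c2 := cvgD (FF := eventually_filter) (cvF3 (al * lf) x) (cvF3 (be * lg) x').
have := cvg_lim (@Rhausdorff R) c1; have := cvg_lim (@Rhausdorff R) c2 => <- <-.
by [].
Qed.

Lemma int_comb_total x : (forall s, int_comb fs s x = 0) -> x = 0.
Proof. by move=> h; apply: fs_total => j; rewrite -(int_comb1 fs) h. Qed.

(** Let [x] and [x'] be the points found for a basis [u], [v] of such a plane. If they are
    independent, the point found for [u + v] contradicts [cubic_rigidity]; if they are proportional,
    another combination of [u] and [v] gives the contradiction. *)
Lemma renormed_read_norm : read_norm V.
Proof.
move=> [E [[u [v [uv EE]]] sub]].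
have attain (al be : R) : (al != 0) || (be != 0) -> exists (x : X) (l : R),
    [/\ x != 0, 0 < l & exists n, forall i, (n <= i)%N -> (al *: u + be *: v) (e i) =
      l * ssum (fun k => a k x ^+ 3 * a k (e i))].
  move=> ab0; have [||x [l [n [x0 l0 h]]]] := @norm_attaining_coords (al *: u + be *: v).
  - by apply/eqP => /uv[al0 be0]; move: ab0; rewrite al0 be0 eqxx.
  - by apply: sub; rewrite EE; exists al => //; exists be.
  - by exists x, l; split=> //; exists n.
have [x [lx [x0 lx0 hx]]] : exists (x : X) (l : R), [/\ x != 0, 0 < l &
    exists n, forall i, (n <= i)%N -> u (e i) = l * ssum (fun k => a k x ^+ 3 * a k (e i))].
  by have := attain 1 0; rewrite oner_eq0 scale1r scale0r addr0; exact.
have [x' [lx' [x'0 lx'0 hx']]] : exists (x : X) (l : R), [/\ x != 0, 0 < l &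
    exists n, forall i, (n <= i)%N -> v (e i) = l * ssum (fun k => a k x ^+ 3 * a k (e i))].
  by have := attain 0 1; rewrite oner_eq0 orbT scale1r scale0r add0r; exact.
have [[s sE]|indep] := pselect (exists s : R, x' = s *: x).
  (* With this coefficient the cubes of the proportional points cancel, so the point [z] found for
     [al *: u + v] would be [0]. *)
  pose al := - (lx' * s ^+ 3 / lx).
  have [|z [lz [z0 lz0 hz]]] := attain al 1; first by rewrite oner_eq0 orbT.
  have := coords_combination erefl hx hx' hz => h.
  case/negP: z0; apply/eqP/int_comb_total => t.
  have := h t; rewrite sE dualZ exprMn /al.
  have -> : - (lx' * s ^+ 3 / lx) * lx * int_comb fs t x ^+ 3 +
      1 * lx' * (s ^+ 3 * int_comb fs t x ^+ 3) = 0.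
    by field; rewrite gt_eqF.
  by move=> /eqP; rewrite mulf_eq0 (gt_eqF lz0)/= expf_eq0 => /andP[_ /eqP].
have [|z [lz [z0 lz0 hz]]] := attain 1 1; first by rewrite oner_eq0.
have := coords_combination erefl hx hx' hz; rewrite !mul1r.
apply: (cubic_rigidity _ _ int_comb_total) => //.
- by move=> i j; exists (i ++ j); exact: int_comb_cat.
- exact: int_comb_opp.
- by rewrite gt_eqF.
- by rewrite gt_eqF.
- by move=> s; apply/eqP => h; apply: indep; exists s.
Qed.

Hypothesis fs_dense :
  forall (f : dual X) (eps : R), 0 < eps -> exists n, `|f - fs n| < eps.

(** [Psi] is uniformly convex in each direction [a k], so the two bidual elements agree on the
    [a k], whose multiples are dense because the [fs] are. *)
Lemma bidual_strictly_convex : strictly_convex (dual (dual V)).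
Proof.
apply: strictly_convex_midpoint => G H G1 H1 GH.
have [v vE] := choice (fun k => renormed_dual (a k)).
have agree k : G (v k) = H (v k).
  apply: (bidual_agree _ G1 H1 GH) => eps eps0.
  have e20 : 0 < eps / 2 by rewrite divr_gt0.
  (* By [pow4_tangent] the fourth power of the norm of the midpoint then exceeds
     [1 - (eps / 2) ^+ 4]. *)
  exists ((eps / 2) ^+ 4 / 2) => [|x x' x1 x'1 xx'].
    by rewrite divr_gt0// exprn_gt0.
  have := Psi_midpoint x x' k; rewrite -!q4 => h.
  have qx : q x ^+ 4 <= 1 by rewrite exprn_ile1.
  have qx' : q x' ^+ 4 <= 1 by rewrite exprn_ile1.
  have := pow4_tangent (q (2^-1 *: (x + x'))).
  have qm : q (2^-1 *: (x + x')) = 2^-1 * `|x + x'|.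
    by rewrite eqnormZ ger0_norm// invr_ge0.
  rewrite {1}qm => h2.
  have : (a k (x - x') / 2) ^+ 4 <= (eps / 2) ^+ 4 by lra.
  rewrite pow4_le ?(ltW e20)// normrM [`|2^-1|]ger0_norm ?invr_ge0//.
  rewrite ler_pM2r ?invr_gt0// => h3.
  by rewrite -dualB vE.
apply/val_inj/funext => g; apply/eqP; rewrite -subr_eq0 -normr_le0.
apply/ler_addgt0Pr => eps eps0; rewrite add0r -[X in `|X|]/((G - H) g).
have [g' g'E] := dual_renormed g.
have [k [K [k0 hq]]] := eqnorm_equiv q.
(* [k^-1] bounds the original norm in terms of [q], and [(1 - d)^-1] bounds [b] in terms of [q]. *)
pose C := k^-1 + (1 - d)^-1.
have d10 : 0 < 1 - d by move: (d13); lra.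
have C0 : 0 < C by rewrite addr_gt0 ?invr_gt0.
have D0 : 0 < `|G - H| + 1 by rewrite ltr_wpDl.
pose eta := eps / (C * (`|G - H| + 1)).
have eta0 : 0 < eta by rewrite divr_gt0// mulr_gt0.
have [n hn] := fs_dense g' eta0.
have [p [c hc]] := a_approx [:: (n, 1)] eta0.
have gv : `|g - c *: v p| <= eta * C.
  apply: dual_norm_le_mul => [|x]; first by rewrite mulr_ge0// ltW.
  rewrite dual_subE dual_scaleE vE -g'E.
  have -> : g' x - c * a p x = (g' - fs n) x + (int_comb fs [:: (n, 1)] x - c * a p x).
    by rewrite int_comb1 dual_subE; ring.
  apply: le_trans (ler_normD _ _) _; rewrite /C mulrDr mulrDl; apply: lerD.
    apply: le_trans (dual_apply_le _ _) _; rewrite -mulrA.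
    apply: ler_pM => //; first exact: ltW.
    by rewrite ler_pdivlMl//; have /andP[] := hq x.
  apply: le_trans (hc x) _; rewrite -[leRHS]mulrA; apply: ler_wpM2l; first exact: ltW.
  by rewrite ler_pdivlMl//; exact: q_ge_b.
have -> : (G - H) g = (G - H) (g - c *: v p).
  by rewrite dualB dualZ [(G - H) (v p)]dual_subE agree subrr mulr0 subr0.
apply: le_trans (dual_apply_le _ _) _.
apply: le_trans (ler_wpM2l _ gv) _ => //.
rewrite /eta; set A := `|G - H| in D0 *.
have -> : A * (eps / (C * (A + 1)) * C) = eps * (A / (A + 1)).
  by field; rewrite !gt_eqF.
by rewrite ler_piMr ?(ltW eps0)// ler_pdivrMr// mul1r lerDl.
Qed.

Lemma dual_smooth : smooth (dual V).
Proof. exact: smooth_of_dual bidual_strictly_convex. Qed.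

End Geometry.

(** * Choice of the functionals and of the parameters of the renorming *)

(** Norming functionals of a dense sequence separate points; if the dual is separable, a dense
    sequence of it also does and is taken instead. *)
Lemma total_sequence {R : realType} {X : normedModType R} : separable X ->
  exists fs : nat -> dual X, (forall x, (forall j, fs j x = 0) -> x = 0) /\
    (separable (dual X) ->
     forall (f : dual X) (eps : R), 0 < eps -> exists n, `|f - fs n| < eps).
Proof.
move=> sepX; have [sepX'|nsepX'] := pselect (separable (dual X)).
  have [fs fs_dense] := separable_seq sepX'; exists fs; split=> // x fx.
  have [f [f1 fxE]] := norming x.
  apply/eqP; rewrite -normr_le0 -fxE; apply/ler_addgt0Pr => eps eps0.
  have x1 : 0 < `|x| + 1 by rewrite ltr_wpDl.
  have [n hn] := fs_dense f _ (divr_gt0 eps0 x1).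
  rewrite add0r; have -> : f x = (f - fs n) x by rewrite dual_subE fx subr0.
  apply: le_trans (dual_apply_ub _ _) _.
  apply: le_trans (ler_wpM2r _ (ltW hn)) _ => //.
  by rewrite mulrAC ler_pdivrMr// ler_wpM2l ?(ltW eps0)// lerDl.
have [xs xs_dense] := separable_seq sepX.
have [fs fsP] := choice (fun j => norming (xs j)).
exists fs; split=> // x fx.
apply/eqP; rewrite -normr_le0; apply/ler_addgt0Pr => eps eps0; rewrite add0r.
have e2 : 0 < eps / 2 by rewrite divr_gt0.
have [n hn] := xs_dense x _ e2; have [fn1 fnx] := fsP n.
have : `|xs n| <= `|x - xs n|.
  have -> : `|xs n| = fs n (xs n - x) by rewrite dualB fnx fx subr0.
  apply: le_trans (dual_apply_ub _ _) _.
  by rewrite distrC ler_piMl.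
have := ler_normD (x - xs n) (xs n); rewrite subrK; lra.
Qed.

Lemma rough_le {R : realType} {V : normedModType R} (r r' : R) :
  r' <= r -> rough V r -> rough V r'.
Proof. by move=> rr h x; apply: le_trans (h x); rewrite lee_fin. Qed.

Theorem proposition4p7 (R : realType) (X : completeNormedModType R)
    (sepX : separable X) (c0X : contains_iso_copy (c0 R) X)
    (eps : R) (eps_range : 0 < eps < 2) :
  exists q : equiv_norm X,
    [/\ read_norm (renormed q),
        strictly_convex (renormed q),
        strictly_convex (dual (renormed q)) /\ smooth (renormed q),
        rough (dual (renormed q)) (2 - eps) /\
          (forall (f : dual (renormed q)) (alpha : R), f != 0 -> 0 < alpha ->
             ((2 - eps)%:E <= diameter (slice f alpha))%E)
      & separable (dual X) ->
          strictly_convex (dual (dual (renormed q))) /\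
          smooth (dual (renormed q))].
Proof.
have /andP[eps0 eps2] := eps_range.
have [J [m [M [m0 Jm]]]] := c0X.
have [xs xs_dense] := separable_seq sepX.
have [fs [fs_total fs_dense]] := total_sequence sepX.
have [e [T [P [C [C0 [TC PC] [Pe Te] fse e_null]]]]] :=
  c0_projection m0 Jm fs xs_dense.
(* Since [P (e i) = e i], adding [t *: e i] leaves [x - P x] unchanged and alters a single
   coordinate of [T x]; this gives [b_bump]. *)
pose b x : R := Num.max `|T x| `|x - P x|.
have Tb x : `|T x| <= b x by rewrite le_max lexx.
have Qb x : `|x - P x| <= b x by rewrite le_max lexx orbT.
have b_le x (r : R) : `|T x| <= r -> `|x - P x| <= r -> b x <= r.
  by rewrite /b ge_max => -> ->.
have b0 x : 0 <= b x by exact: le_trans (Tb x).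
have bD x x' : b (x + x') <= b x + b x'.
  apply: b_le.
    by rewrite linearD; apply: le_trans (ler_normD _ _) _; exact: lerD.
  rewrite linearD opprD addrACA.
  by apply: le_trans (ler_normD _ _) _; exact: lerD.
have bZ (c : R) x : b (c *: x) = `|c| * b x.
  have TZ : T (c *: x) = c *: T x by exact: linearZ.
  have PZ : P (c *: x) = c *: P x by exact: linearZ.
  by rewrite /b TZ PZ -scalerBr !normrZ maxr_pMr.
have bm x : `|x| <= (1 + C) * b x.
  rewrite -[x in leLHS](subrK (P x)); apply: le_trans (ler_normD _ _) _.
  rewrite mulrDl mul1r lerD//; apply: le_trans (PC x) _.
  by rewrite ler_wpM2l// ltW.
have bM x : b x <= (1 + C + C * C) * `|x|.
  have CC : 0 <= C * C * `|x| by rewrite !mulr_ge0// ltW.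
  have Cx : 0 <= C * `|x| by rewrite mulr_ge0// ltW.
  apply: b_le.
    by apply: le_trans (TC x) _; have := normr_ge0 x; lra.
  apply: le_trans (ler_normB _ _) _.
  have := PC x; have := ler_wpM2l (ltW C0) (TC x); lra.
have b_bump x i (t : R) : b (x + t *: e i) <= Num.max (b x) (`|t| + `|T x i|).
  have TE : T (x + t *: e i) = T x + t *: T (e i) by rewrite linearD linearZ.
  have PE : P (x + t *: e i) = P x + t *: e i by rewrite linearD linearZ /= Pe.
  apply: b_le; last first.
    by rewrite PE opprD addrACA subrr addr0 le_max Qb.
  apply: c0_norm_le => j; rewrite TE -[X in `|X|]/(T x j + t * T (e i) j) Te.
  have [->|_] := eqVneq j i.
    by rewrite mulr1 le_max addrC ler_normD orbT.
  rewrite mulr0 addr0 le_max; apply/orP; left.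
  exact: le_trans (c0_normE _ _) (Tb x).
have be1 i : 1 <= b (e i).
  by apply: le_trans (Tb _); apply: le_trans (c0_normE _ i); rewrite Te eqxx normr1.
(* Then [12 * d = eps / 2], and [eps < 2] gives [d <= 12^-1]. *)
pose d : R := eps / 24.
have d0 : 0 < d by rewrite divr_gt0.
have d1 : d <= 12^-1 by rewrite /d; lra.
have deps : 2 - eps <= 2 - 12 * d by rewrite /d; lra.
have C1 : 0 <= 1 + C by rewrite addr_ge0// ltW.
have d11 : d <= 1 by rewrite /d; lra.
have [a [ab ae a_indep a_approx]] := independent_family C1 bm bM b0 Tb Te fse d0 d11.
(* Nonzero factors shrink the dense sequence enough for [y_le] and keep its directions. *)
pose cs i := d / 2 * 2^-1 ^+ i * 2^-1 ^+ i / (1 + b (xs i)).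
have b1 i : 0 < 1 + b (xs i) by rewrite ltr_pwDl.
have cs0 i : 0 < cs i.
  by rewrite divr_gt0// mulr_gt0 ?exp_half_gt0// mulr_gt0 ?exp_half_gt0// divr_gt0.
have csn0 i : cs i != 0 by rewrite gt_eqF.
have y_le i : b (cs i *: xs i) <= d / 2 * 2^-1 ^+ i * 2^-1 ^+ i.
  rewrite bZ gtr0_norm// /cs mulrAC ler_pdivrMr// ler_wpM2l ?lerDr//.
  apply: mulr_ge0 (exp_half_ge0 _); apply: mulr_ge0 (exp_half_ge0 _).
  by rewrite divr_ge0// ltW.
have yE i : (fun i => cs i *: xs i) i = cs i *: xs i by [].
have Cp : 0 < 1 + C by rewrite addr_gt0.
have Mp : 0 < 1 + C + C * C by rewrite addr_gt0// mulr_gt0.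
have [q [q0 q4]] := Psi_norm bD bZ b0 Cp Mp bm bM d0 d1 y_le ab.
exists q; split.
- exact: (renormed_read_norm bD bZ b0 d0 d1 y_le Tb b_bump fs_total ab a_indep
    a_approx q0 q4).
- exact: (renormed_strictly_convex bD bZ b0 fs_total ab a_approx q4).
- split.
    exact: (dual_strictly_convex bD bZ b0 d0 d1 xs_dense yE csn0 y_le ab q0 q4).
  exact: (renormed_smooth bD bZ b0 d0 d1 xs_dense yE csn0 y_le ab q0 q4).
- split.
    apply: rough_le deps _.
    exact: (dual_rough bD bZ b0 d0 d1 y_le Tb be1 b_bump e_null ab ae q0 q4).
  move=> f alpha f0 al0; apply: le_trans (_ : (2 - 12 * d)%:E <= _)%E.
    by rewrite lee_fin.
  exact: (renormed_slice_diameter bD bZ b0 d0 d1 y_le Tb be1 b_bump e_null ab ae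
    q0 q4 f0 al0).
- move=> /fs_dense fsd; split.
    exact: (bidual_strictly_convex bD bZ b0 d0 d1 y_le ab a_approx q0 q4 fsd).
  exact: (dual_smooth bD bZ b0 d0 d1 y_le ab a_approx q0 q4 fsd).
Qed.
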